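(* There exists a procedure which takes as input any three parabolic elements $A,B,C\in \operatorname{PSL}(2,\mathbf{R})$ such that the subgroup $\Gamma=\langle A,B,C\rangle$ of $\operatorname{PSL}(2,\mathbf{R})$ is non-elementary and free of rank $3$, and which determines whether or not $\Gamma$ is a discrete subgroup of $\operatorname{PSL}(2,\mathbf{R})$. Furthermore, the procedure is an algorithm on those inputs for which $\Gamma$ contains no elliptic elements: for every such input it halts after finitely many steps with the correct answer.
   Context: $\operatorname{PSL}(2,\mathbf{R})=\operatorname{SL}(2,\mathbf{R})/\{\pm I\}$ acts by Möbius transformations on the hyperbolic upper half plane $\mathbb{H}$ and on its boundary $\mathbf{R}\cup\{\infty\}$. A non-identity element $g$ with matrix entries $a,b,c,d$ is elliptic, parabolic or hyperbolic according to whether $|\operatorname{Tr} g|=|a+d|$ is $<2$, $=2$ or $>2$; equivalently, $g$ has one fixed point in $\mathbb{H}$, exactly one fixed point on the boundary, or two fixed points on the boundary. The limit set $\Lambda(\Gamma)$ is the set of limit points of the orbits $\Gamma\cdot z_0$, $z_0\in\mathbb{H}$. A subgroup $\Gamma$ is elementary if it has a finite orbit in $\Lambda(\Gamma)$, and non-elementary otherwise. Procedures and algorithms: a procedure is a step-by-step rule acting on the real matrix entries of the input elements, where the steps are exact real arithmetic operations on matrix entries (such as forming products, inverses and conjugates of the current elements) and branching on comparisons of real numbers. It determines discreteness in the sense that, whenever it halts, it outputs ''discrete'' or ''not discrete'' correctly for the input. In general a procedure is allowed not to halt on some inputs. A procedure is an algorithm on a class of inputs if it halts after a finite number of steps on every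 input of that class. *)

(* Defs.v *)
From HB Require Import structures.
From mathcomp Require Import all_boot all_order all_algebra.
From mathcomp Require Import complex.
From mathcomp Require Import all_classical all_reals all_analysis.

Set Implicit Arguments.
Unset Strict Implicit.
Unset Printing Implicit Defensive.

Import Order.TTheory GRing.Theory Num.Theory.
Import numFieldNormedType.Exports.

Local Open Scope classical_set_scope.
Local Open Scope quotient_scope.
Local Open Scope ring_scope.

Section SL2.
Variable R : realType.

Record SL2 : Type := MkSL2 {
  SL2_val :> 'M[R]_2;
  SL2_detP : \det SL2_val == 1
}.

HB.instance Definition _ := [isSub for SL2_val].
HB.instance Definition _ := [Choice of SL2 by <:].
HB.instance Definition _ :=
  Topological.copy SL2 (initial_topology SL2_val).

Lemma SL2_det (A : SL2) : \det A = 1.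
Proof. exact/eqP/SL2_detP. Qed.

Lemma SL2_unit (A : SL2) : (A : 'M[R]_2) \in unitmx.
Proof. by rewrite unitmxE SL2_det unitr1. Qed.

Fact SL2_one_subproof : \det (1%:M : 'M[R]_2) == 1.
Proof. by rewrite det1. Qed.
Definition SL2_one : SL2 := MkSL2 SL2_one_subproof.

Fact SL2_mul_subproof (A B : SL2) : \det (A *m B) == 1.
Proof. by rewrite det_mulmx !SL2_det mulr1. Qed.
Definition SL2_mul (A B : SL2) : SL2 := MkSL2 (SL2_mul_subproof A B).

Fact SL2_inv_subproof (A : SL2) : \det (invmx A) == 1.
Proof. by rewrite det_inv SL2_det invr1. Qed.
Definition SL2_inv (A : SL2) : SL2 := MkSL2 (SL2_inv_subproof A).

Fact SL2_mulA : associative SL2_mul.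
Proof. by move=> A B C; apply/val_inj; rewrite /= mulmxA. Qed.
Fact SL2_mul1 : left_id SL2_one SL2_mul.
Proof. by move=> A; apply/val_inj; rewrite /= mul1mx. Qed.
Fact SL2_mulr1 : right_id SL2_one SL2_mul.
Proof. by move=> A; apply/val_inj; rewrite /= mulmx1. Qed.
Fact SL2_mulV : left_inverse SL2_one SL2_inv SL2_mul.
Proof. by move=> A; apply/val_inj; rewrite /= mulVmx ?SL2_unit. Qed.
Fact SL2_mulrV : right_inverse SL2_one SL2_inv SL2_mul.
Proof. by move=> A; apply/val_inj; rewrite /= mulmxV ?SL2_unit. Qed.

HB.instance Definition _ :=
  isGroup.Build SL2 SL2_mulA SL2_mul1 SL2_mulr1 SL2_mulV SL2_mulrV.

(* Equality modulo {I, -I}. *)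
Definition pm_rel (A B : SL2) : bool :=
  (SL2_val A == SL2_val B) || (SL2_val A == - SL2_val B).

Lemma pm_relP (A B : SL2) :
  reflect (SL2_val A = SL2_val B \/ SL2_val A = - SL2_val B) (pm_rel A B).
Proof. by apply: (iffP orP) => -[] /eqP; [left|right|left|right]. Qed.

Fact pm_rel_refl : reflexive pm_rel.
Proof. by move=> A; apply/pm_relP; left. Qed.
Fact pm_rel_sym : symmetric pm_rel.
Proof.
by move=> A B; apply/pm_relP/pm_relP => -[]->; [left|right|left|right];
  rewrite ?opprK.
Qed.
Fact pm_rel_trans : transitive pm_rel.
Proof.
move=> B A C /pm_relP[]AB /pm_relP[]BC; apply/pm_relP; rewrite AB BC ?opprK;
  by [left|right].
Qed.

Canonical pm_equiv := EquivRel pm_rel pm_rel_refl pm_rel_sym pm_rel_trans.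

End SL2.

Section PSL2.
Variable R : realType.
Notation SL2 := (SL2 R).

Definition PSL2 : Type := quotient_topology {eq_quot @pm_rel R}.

HB.instance Definition _ := Quotient.on PSL2.
HB.instance Definition _ := Topological.on PSL2.
HB.instance Definition _ := Choice.on PSL2.

Lemma PSL2_eqP (A B : SL2) :
  reflect (SL2_val A = SL2_val B \/ SL2_val A = - SL2_val B)
    (\pi_PSL2 A == \pi_PSL2 B).
Proof.
have eqP' := @eqquotP _ _ {eq_quot @pm_rel R} A B.
by apply: (iffP eqP) => [/(@eqP')/pm_relP|/pm_relP/eqP'].
Qed.

Lemma repr_PSL2 (A : SL2) :
  SL2_val (repr (\pi_PSL2 A)) = SL2_val A \/
  SL2_val (repr (\pi_PSL2 A)) = - SL2_val A.
Proof. by apply/PSL2_eqP; rewrite reprK. Qed.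

Lemma PSL2_lift (x : PSL2) : exists A : SL2, x = \pi_PSL2 A.
Proof. by exists (repr x); rewrite reprK. Qed.

Definition PSL2_one : PSL2 := \pi_PSL2 1%g.
Definition PSL2_mul (x y : PSL2) : PSL2 := \pi_PSL2 (repr x * repr y)%g.
Definition PSL2_inv (x : PSL2) : PSL2 := \pi_PSL2 (repr x)^-1%g.

Lemma PSL2_piM (A B : SL2) :
  PSL2_mul (\pi_PSL2 A) (\pi_PSL2 B) = \pi_PSL2 (A * B)%g.
Proof.
apply/eqP/PSL2_eqP => /=.
have [-> | ->] := repr_PSL2 A; have [-> | ->] := repr_PSL2 B;
  rewrite ?mulNmx ?mulmxN ?opprK; by [left|right].
Qed.

Lemma PSL2_piV (A : SL2) : PSL2_inv (\pi_PSL2 A) = \pi_PSL2 A^-1%g.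
Proof.
apply/eqP/PSL2_eqP => /=.
have [-> | ->] := repr_PSL2 A; [by left|right].
by rewrite -scaleN1r invmxZ ?scaleN1r ?SL2_unit ?invrN1 ?scaleN1r //;
  rewrite -scaleN1r unitmxZ ?SL2_unit ?unitrN1.
Qed.

Fact PSL2_mulA : associative PSL2_mul.
Proof.
move=> x y z; have [A ->] := PSL2_lift x; have [B ->] := PSL2_lift y.
by have [C ->] := PSL2_lift z; rewrite !PSL2_piM mulgA.
Qed.
Fact PSL2_mul1 : left_id PSL2_one PSL2_mul.
Proof. by move=> x; have [A ->] := PSL2_lift x; rewrite PSL2_piM mul1g. Qed.
Fact PSL2_mulr1 : right_id PSL2_one PSL2_mul.
Proof. by move=> x; have [A ->] := PSL2_lift x; rewrite PSL2_piM mulg1. Qed.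
Fact PSL2_mulV : left_inverse PSL2_one PSL2_inv PSL2_mul.
Proof.
by move=> x; have [A ->] := PSL2_lift x; rewrite PSL2_piV PSL2_piM mulVg.
Qed.
Fact PSL2_mulrV : right_inverse PSL2_one PSL2_inv PSL2_mul.
Proof.
by move=> x; have [A ->] := PSL2_lift x; rewrite PSL2_piV PSL2_piM mulgV.
Qed.

HB.instance Definition _ :=
  isGroup.Build PSL2 PSL2_mulA PSL2_mul1 PSL2_mulr1 PSL2_mulV PSL2_mulrV.

Definition abs_trace (g : PSL2) : R := `|\tr (repr g)|.

Lemma abs_trace_pi (A : SL2) : abs_trace (\pi_PSL2 A) = `|\tr A|.
Proof.
by rewrite /abs_trace; have [-> | ->] := repr_PSL2 A; rewrite ?linearN ?normrN.
Qed.

Definition elliptic (g : PSL2) : Prop := g <> 1%g /\ abs_trace g < 2.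
Definition parabolic (g : PSL2) : Prop := g <> 1%g /\ abs_trace g = 2.

(* The Riemann sphere. R[i] gets its topology from its numFieldType. *)
Definition complex_plane : numClosedFieldType := R[i].
Definition sphere : Type := one_point_compactification complex_plane.

HB.instance Definition _ := Choice.on sphere.
HB.instance Definition _ := Topological.on sphere.

Definition upper_half_plane : set sphere :=
  [set x | exists2 z : R[i], 0 < complex.Im z & x = Some z].

(* [None] is the point at infinity. *)
Definition mobius (A : 'M[R]_2) (x : sphere) : sphere :=
  let a := (A 0 0)%:C%C in let b := (A 0 1)%:C%C in
  let c := (A 1 0)%:C%C in let d := (A 1 1)%:C%C in
  match x with
  | Some z => if c * z + d == 0 then None else Some ((a * z + b) / (c * z + d))
  | None => if c == 0 then None else Some (a / c)
  end.

Definition PSL2_act (g : PSL2) (x : sphere) : sphere := mobius (repr g) x.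

Lemma PSL2_act_pi (A : SL2) (x : sphere) :
  PSL2_act (\pi_PSL2 A) x = mobius A x.
Proof.
have mobiusN (M : 'M[R]_2) : mobius (- M) x = mobius M x.
  rewrite /mobius !mxE !(rmorphN (real_complex R)).
  case: x => [z|]; rewrite ?mulNr -?opprD oppr_eq0 invrN ?mulrNN //.
  by rewrite mulrN opprK.
by rewrite /PSL2_act; have [-> | ->] := repr_PSL2 A; rewrite ?mobiusN.
Qed.

Definition PSL2_orbit (G : set PSL2) (x : sphere) : set sphere :=
  [set PSL2_act g x | g in G].

(* Limit points are taken in the whole sphere: for a non-discrete group the
   orbits may also accumulate inside the upper half plane. *)
Definition limit_set (G : set PSL2) : set sphere :=
  \bigcup_(z0 in upper_half_plane) limit_point (PSL2_orbit G z0).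

Definition elementary (G : set PSL2) : Prop :=
  exists2 x, limit_set G x & finite_set (PSL2_orbit G x).

Definition discrete_subgroup (G : set PSL2) : Prop :=
  forall g, G g -> isolated G g.

End PSL2.

Section GroupTheory.
Variable G : groupType.

Definition subgroup (H : set G) : Prop :=
  H 1%g /\ forall x y, H x -> H y -> H (x * y^-1)%g.

Definition generated_subgroup (S : set G) : set G := smallest subgroup S.

(* The letter (i, b) stands for the i-th generator, inverted if b. *)
Definition reduced_word n (w : seq ('I_n * bool)) : bool :=
  sorted (fun k l => ~~ ((k.1 == l.1) && (k.2 != l.2))) w.

Definition eval_word n (x : 'I_n -> G) (w : seq ('I_n * bool)) : G :=
  foldr (fun l g => ((if l.2 then (x l.1)^-1 else x l.1) * g)%g) 1%g w.

(* Some basis of n elements exists; it need not be a given generating family. *)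
Definition free_of_rank (n : nat) (H : set G) : Prop :=
  exists x : 'I_n -> G,
    H = generated_subgroup (range x) /\
    forall w, reduced_word w -> w <> [::] -> eval_word x w <> 1%g.

End GroupTheory.

(* Procedures are programs of a real RAM without floor function: a program acts
   on two infinite arrays of registers, one of natural numbers (loop counters,
   indices, finite combinatorial data) and one of real numbers. Real numbers
   are only accessible through field operations and comparisons, and the only
   real constants are rational; x^-1 = 0 when x = 0. *)
Inductive nexpr :=
  | NConst of nat
  | NReg of nexpr
  | NAdd of nexpr & nexpr
  | NSub of nexpr & nexpr
  | NMul of nexpr & nexpr
  | NDiv of nexpr & nexpr
  | NMod of nexpr & nexpr.

Inductive rexpr :=
  | RConst of rat
  | RReg of nexpr
  | RAdd of rexpr & rexpr
  | ROpp of rexpr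
  | RMul of rexpr & rexpr
  | RInv of rexpr.

Inductive test :=
  | NLt of nexpr & nexpr
  | RLt of rexpr & rexpr
  | TNot of test
  | TAnd of test & test.

Inductive program :=
  | Skip
  | SetN of nexpr & nexpr
  | SetR of nexpr & rexpr
  | Seq of program & program
  | If of test & program & program
  | While of test & program.

Section Semantics.
Variable R : realType.

Record memory := Memory { nmem : nat -> nat; rmem : nat -> R }.

Fixpoint neval (m : memory) (e : nexpr) : nat :=
  match e with
  | NConst n => n
  | NReg a => nmem m (neval m a)
  | NAdd e1 e2 => (neval m e1 + neval m e2)%N
  | NSub e1 e2 => (neval m e1 - neval m e2)%N
  | NMul e1 e2 => (neval m e1 * neval m e2)%N
  | NDiv e1 e2 => (neval m e1 %/ neval m e2)%N
  | NMod e1 e2 => (neval m e1 %% neval m e2)%N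
  end.

Fixpoint reval (m : memory) (e : rexpr) : R :=
  match e with
  | RConst q => ratr q
  | RReg a => rmem m (neval m a)
  | RAdd e1 e2 => reval m e1 + reval m e2
  | ROpp e1 => - reval m e1
  | RMul e1 e2 => reval m e1 * reval m e2
  | RInv e1 => (reval m e1)^-1
  end.

Fixpoint teval (m : memory) (t : test) : bool :=
  match t with
  | NLt e1 e2 => (neval m e1 < neval m e2)%N
  | RLt e1 e2 => reval m e1 < reval m e2
  | TNot t1 => ~~ teval m t1
  | TAnd t1 t2 => teval m t1 && teval m t2
  end.

(* The list is the stack of programs that remain to be executed. *)
Definition config : Type := seq program * memory.

Definition step (c : config) : config :=
  let: (k, m) := c in
  match k with
  | [::] => c
  | Skip :: k' => (k', m)
  | SetN a e :: k' =>
      (k', Memory [eta nmem m with neval m a |-> neval m e] (rmem m))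
  | SetR a e :: k' =>
      (k', Memory (nmem m) [eta rmem m with neval m a |-> reval m e])
  | Seq p q :: k' => ([:: p, q & k'], m)
  | If t p q :: k' => ((if teval m t then p else q) :: k', m)
  | While t p :: k' => (if teval m t then [:: p, While t p & k'] else k', m)
  end.

Definition halts_in (P : program) (m : memory) (n : nat) (m' : memory) : Prop :=
  iter n step ([:: P], m) = ([::], m').

(* The answer is read off natural register 0 once the program has halted:
   0 is "not discrete", anything else is "discrete". *)
Definition outputs (P : program) (m : memory) (answer : bool) : Prop :=
  exists n m', halts_in P m n m' /\ answer = (nmem m' 0 != 0%N).

Definition entries (A : 'M[R]_2) : seq R := [:: A 0 0; A 0 1; A 1 0; A 1 1].

(* Real registers 0 to 11 hold the entries of A, B, C; every other register is
   initially 0. *)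
Definition input (A B C : SL2 R) : memory :=
  Memory (fun _ => 0%N) (nth 0 (entries A ++ entries B ++ entries C)).

End Semantics.

(* Main.v *)
Require Import Defs.
From HB Require Import structures.
From mathcomp Require Import fingroup perm.
From mathcomp Require Import all_boot all_order all_algebra.
From mathcomp Require Import all_classical all_reals all_analysis.
From mathcomp Require Import ring lra zify.

(* Up to sign and inversion a parabolic element is a transvection
   T_u : q |-> q + omega(u, q) u, so Gamma = <T_u, T_v, T_w> is described by
   x = omega(u, v), y = omega(v, w), z = omega(w, u).  Replacing w by
   T_v^{+-1} w does not change Gamma and replaces |z| by ||z| - |x y||.  The
   procedure performs such Markov-type moves that decrease |x| + |y| + |z|, on
   the rational data x^2, y^2, z^2, +- x y z, until
   kappa = x^2 + y^2 + z^2 - |x y z| <= 0, and then answers "discrete".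

   If kappa <= 0, a ping-pong argument on R^2 shows that, for every g in Gamma
   and every e in {u, v, w}, omega(e, g e) is 0 or at least 2 in absolute value;
   since an element of SL(2, R) fixing three lines is +- 1, Gamma is discrete.

   If Gamma contains no elliptic element, the traces 2 - x^2, 2 - kappa and
   x^2 - 6 (when kappa = 4) of T_u T_v, T_u T_v T_w and T_u T_v T_w^2, for
   suitable orientations, yield |x|, |y|, |z| >= 2, kappa <= 0 or kappa >= 4, and
   x^2, y^2, z^2 >= 8 when kappa = 4; freeness excludes x = 0 and the case
   kappa = 4, x^2 = 4, where T_u T_v and T_w commute.  As long as kappa >= 4,
   (2 |z| - |x y|)^2 = (x^2 - 4) (y^2 - 4) + 4 (kappa - 4) bounds the progress of
   a move from below: either the move gains at least 4, or it preserves kappa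
   and gains at least 2 sqrt(kappa - 4).  Hence the procedure halts. *)

Set Implicit Arguments.
Unset Strict Implicit.
Unset Printing Implicit Defensive.

Import Order.TTheory GRing.Theory Num.Theory.
Import numFieldNormedType.Exports.

Local Open Scope classical_set_scope.
Local Open Scope quotient_scope.
Local Open Scope ring_scope.

(** * Free groups *)

Section FreeGroups.

Lemma subgroup_generated (G : groupType) (S : set G) :
  subgroup (generated_subgroup S).
Proof.
rewrite /generated_subgroup /smallest; split=> [|x y Sx Sy] M /= [[M1 MV] SM] //.
have := conj (Sx M (conj (conj M1 MV) SM)) (Sy M (conj (conj M1 MV) SM)).
by move=> [Mx My]; exact: MV.
Qed.

Lemma generated_sub (G : groupType) (S H : set G) :
  subgroup H -> S `<=` H -> generated_subgroup S `<=` H.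
Proof. exact: smallest_sub. Qed.

Lemma sub_generated (G : groupType) (S : set G) : S `<=` generated_subgroup S.
Proof. exact: sub_gen_smallest. Qed.

Lemma subgroupV (G : groupType) (H : set G) x : subgroup H -> H x -> H x^-1%g.
Proof. by move=> [H1 HV] Hx; rewrite -[x^-1%g]mul1g; exact: HV. Qed.

Lemma subgroupM (G : groupType) (H : set G) x y :
  subgroup H -> H x -> H y -> H (x * y)%g.
Proof.
by move=> sH Hx Hy; rewrite -[y]invgK; apply: (sH.2) => //; exact: subgroupV.
Qed.

(** * Words, relations and images of free generators in finite groups *)

Definition letter_inv n (l : 'I_n * bool) := (l.1, ~~ l.2).
Definition word_inv n (w : seq ('I_n * bool)) := rev (map (@letter_inv n) w).

Lemma eval_word_cat (G : groupType) n (x : 'I_n -> G) w1 w2 :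
  eval_word x (w1 ++ w2) = (eval_word x w1 * eval_word x w2)%g.
Proof.
elim: w1 => [|l w1 IH] /=; first by rewrite mul1g.
by rewrite IH mulgA.
Qed.

Lemma eval_word_inv (G : groupType) n (x : 'I_n -> G) w :
  eval_word x (word_inv w) = (eval_word x w)^-1%g.
Proof.
elim: w => [|[i b] w IH]; first by rewrite /= invg1.
rewrite /word_inv /= rev_cons -cats1 eval_word_cat -/(word_inv w) IH /= mulg1.
by rewrite invgM; case: b; rewrite ?invgK.
Qed.

Lemma subgroup_words (G : groupType) n (x : 'I_n -> G) :
  subgroup (range (eval_word x)).
Proof.
split; first by exists [::].
by move=> _ _ [w1 _ <-] [w2 _ <-]; exists (w1 ++ word_inv w2);
  rewrite // eval_word_cat eval_word_inv.
Qed.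

Lemma generated_words (G : groupType) n (x : 'I_n -> G) :
  generated_subgroup (range x) `<=` range (eval_word x).
Proof.
apply: generated_sub; first exact: subgroup_words.
by move=> _ [i _ <-]; exists [:: (i, false)] => //=; rewrite mulg1.
Qed.

Definition word_subst n k (v : 'I_n -> seq ('I_k * bool)) (w : seq ('I_n * bool)) :=
  flatten [seq (if l.2 then word_inv (v l.1) else v l.1) | l <- w].

Lemma eval_word_subst (G : groupType) n k (x : 'I_k -> G)
    (v : 'I_n -> seq ('I_k * bool)) w :
  eval_word x (word_subst v w) = eval_word (fun i => eval_word x (v i)) w.
Proof.
elim: w => [//|[i b] w IH]; rewrite /word_subst /= eval_word_cat.
by rewrite -/(word_subst v w) IH; case: b => //=; rewrite eval_word_inv.
Qed.

(** The reduced word is chosen independently of the group, so that one reduction serves a free group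
    and all targets of its homomorphisms at once. *)
Lemma word_reduce n (w : seq ('I_n * bool)) :
  exists2 w0, reduced_word w0 &
    forall (G : groupType) (x : 'I_n -> G), eval_word x w = eval_word x w0.
Proof.
elim: w => [|[i b] w [w0 rw0 ew0]]; first by exists [::].
case: w0 => [|[j d] w1] in rw0 ew0 *.
  by exists [:: (i, b)] => // G x; rewrite /= ew0.
have [/andP[/eqP eij nbd]|nc] := boolP ((i == j) && (b != d)).
  exists w1 => [|G x]; first by move: rw0; exact: path_sorted.
  rewrite /= ew0 /= -eij mulgA.
  have -> : b = ~~ d by move: nbd; case: (b); case: (d).
  by case: (d); rewrite /= ?mulVg ?mulgV mul1g.
exists [:: (i, b), (j, d) & w1] => [|G x]; last by rewrite /= ew0.
by rewrite /reduced_word /= nc.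
Qed.

(** Universal property of a basis, stated on words: the reduced form of [w1] times the inverse of
    [w2] is killed by [x], hence is empty, hence is killed by [f]. *)
Lemma free_relation (G H : groupType) n (x : 'I_n -> G) (f : 'I_n -> H) w1 w2 :
  (forall w, reduced_word w -> w <> [::] -> eval_word x w <> 1%g) ->
  eval_word x w1 = eval_word x w2 -> eval_word f w1 = eval_word f w2.
Proof.
move=> xfree e12; have [w0 rw0 ew0] := word_reduce (w1 ++ word_inv w2).
have w0nil : w0 = [::].
  apply: contrapT => /(xfree _ rw0); apply.
  by rewrite -ew0 eval_word_cat eval_word_inv e12 mulgV.
have := ew0 H f; rewrite w0nil /= eval_word_cat eval_word_inv => e1.
by apply/eqP; rewrite -divg_eq1; apply/eqP.
Qed.

(* Evaluating the homomorphism to Q defined by the images of a basis on any other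
   n generators is an injective, hence surjective, self-map of Q ^ n. *)
Lemma free_generators_surj (G : groupType) (Q : finGroupType) n (x g : 'I_n -> G)
    (q : 'I_n -> Q) :
  (forall w, reduced_word w -> w <> [::] -> eval_word x w <> 1%g) ->
  generated_subgroup (range x) = generated_subgroup (range g) ->
  exists (f : 'I_n -> Q) (v : 'I_n -> seq ('I_n * bool)),
    forall i, g i = eval_word x (v i) /\ q i = eval_word f (v i).
Proof.
move=> xfree xg.
have /choice[v ev] : forall i, exists w, eval_word x w = g i.
  move=> i; have : generated_subgroup (range x) (g i).
    by rewrite xg; apply: sub_generated; exists i.
  by move=> /generated_words[w _ <-]; exists w.
have /choice[w ew] : forall i, exists w, eval_word g w = x i.
  move=> i; have : generated_subgroup (range g) (x i).
    by rewrite -xg; apply: sub_generated; exists i.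
  by move=> /generated_words[w' _ <-]; exists w'.
pose psi (f : {ffun 'I_n -> Q}) : {ffun 'I_n -> Q} :=
  [ffun i => eval_word f (v i)].
have psi_inj : injective psi.
  (* The words [w] express the basis [x] through [g], so evaluating them at [psi f] recovers [f]. *)
  have psiK (f : {ffun 'I_n -> Q}) i : f i = eval_word (psi f) (w i).
    have -> : eval_word (psi f) (w i) = eval_word f (word_subst v (w i)).
      rewrite eval_word_subst; congr eval_word; apply/funext => j.
      by rewrite ffunE.
    have <- : eval_word f [:: (i, false)] = f i by rewrite /= mulg1.
    apply: free_relation xfree _; rewrite /= mulg1 eval_word_subst -[LHS]ew.
    by congr eval_word; apply/funext => j; rewrite ev.
  by move=> f f' e; apply/ffunP => i; rewrite psiK e -psiK.
have [f' fK Kf] := injF_bij psi_inj.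
exists (f' (finfun q)), v => i; split; first by rewrite ev.
by have := Kf (finfun q) => /(congr1 (fun h : {ffun _} => h i)); rewrite !ffunE.
Qed.

(** The triple is not assumed to be a basis, but by surjectivity some homomorphism still sends [a]
    and [b] to two transpositions of three points that do not commute. *)
Lemma free_generators_noncomm (G : groupType) (H : set G) (a b c : G) :
  free_of_rank 3 H -> H = generated_subgroup [set a; b; c] ->
  (a * b)%g <> (b * a)%g.
Proof.
move=> [x [Hx xfree]] Habc abba.
pose g (i : 'I_3) : G := nth a [:: a; b; c] i.
have rg : range g = [set a; b; c].
  apply/seteqP; split=> [_ [[[|[|[|//]]] ?] _ <-]|_ [[->|->]|->]].
  - by left; left.
  - by left; right.
  - by right.
  - by exists 0.
  - by exists 1.
  - by exists 2%:R.
pose s : {perm 'I_3} := tperm 0 1.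
pose t : {perm 'I_3} := tperm 1 2%:R.
(* The third generator is sent to the default value [1]. *)
pose q (i : 'I_3) : {perm 'I_3} := nth 1%g [:: s; t] i.
have [||f [v vP]] := @free_generators_surj G _ 3 x g q.
- exact: xfree.
- by rewrite -Hx Habc rg.
have : eval_word f (v 0 ++ v 1) = eval_word f (v 1 ++ v 0).
  apply: free_relation xfree _; rewrite !eval_word_cat.
  by have [<- _] := vP 0; have [<- _] := vP 1.
rewrite !eval_word_cat; have [_ <-] := vP 0; have [_ <-] := vP 1.
rewrite /q /= => /(congr1 (fun p : {perm 'I_3} => p 0)).
by rewrite !permM /s /t tpermL tpermL (tpermD (z := 0)) // tpermL.
Qed.

End FreeGroups.

(** * Transvections *)

Section Transvections.
Variable R : realType.
Implicit Types (u v w q : R * R) (s t : R) (M : 'M[R]_2).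

Definition mx2 (a b c d : R) : 'M[R]_2 :=
  \matrix_(i, j) if i == 0 then if j == 0 then a else b
                 else if j == 0 then c else d.

Lemma mx2P M : M = mx2 (M 0 0) (M 0 1) (M 1 0) (M 1 1).
Proof.
apply/matrixP => i j; rewrite mxE.
by case: i j => -[|[|//]] ? [[|[|//]] ?] /=; congr (M _ _); apply/val_inj.
Qed.

Lemma mul_mx2 a b c d a' b' c' d' :
  mx2 a b c d *m mx2 a' b' c' d' =
  mx2 (a * a' + b * c') (a * b' + b * d') (c * a' + d * c') (c * b' + d * d').
Proof.
apply/matrixP => i j; rewrite !mxE !big_ord_recl big_ord0 !mxE addr0 /=.
by case: i j => -[|[|//]] ? [[|[|//]] ?].
Qed.

Lemma scale_mx2 s a b c d : s *: mx2 a b c d = mx2 (s * a) (s * b) (s * c) (s * d).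
Proof.
by apply/matrixP => i j; rewrite !mxE; case: ifP => _; case: ifP.
Qed.

Lemma mxtrace_mx2 a b c d : \tr (mx2 a b c d) = a + d.
Proof. by rewrite /mxtrace !big_ord_recl big_ord0 !mxE addr0. Qed.

Lemma det_mx2 a b c d : \det (mx2 a b c d) = a * d - b * c.
Proof.
rewrite (expand_det_row _ 0) !big_ord_recl big_ord0 /cofactor !det_mx11 !mxE /=.
by rewrite expr0 expr1 mul1r addr0 mulN1r mulrN.
Qed.

Lemma mx2_scalar a : a%:M = mx2 a 0 0 a.
Proof.
by apply/matrixP => i j; rewrite !mxE; case: i j => -[|[|//]] ? [[|[|//]] ?].
Qed.

(** * The area form and its transvections *)

Definition omega u v : R := u.1 * v.2 - u.2 * v.1.

Definition mx_act M q : R * R :=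
  (M 0 0 * q.1 + M 0 1 * q.2, M 1 0 * q.1 + M 1 1 * q.2).

Lemma mx_actM M N q : mx_act (M *m N) q = mx_act M (mx_act N q).
Proof.
rewrite (mx2P M) (mx2P N) mul_mx2 /mx_act !mxE /=; congr pair; ring.
Qed.

Lemma mx_act1 q : mx_act 1%:M q = q.
Proof. by case: q => a b; rewrite mx2_scalar /mx_act !mxE /=; congr pair; ring. Qed.

Lemma mx_actN M q : mx_act (- M) q = - mx_act M q.
Proof. by rewrite /mx_act !mxE; congr pair; rewrite /=; ring. Qed.

Definition transv_vec u t q : R * R :=
  (q.1 + t * omega u q * u.1, q.2 + t * omega u q * u.2).

(** The matrix of [T_u ^ t]; the exponent [t] covers powers and inverses alike. *)
Definition transv_mx u t : 'M[R]_2 :=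
  mx2 (1 - t * u.1 * u.2) (t * u.1 * u.1) (- t * u.2 * u.2) (1 + t * u.1 * u.2).

Fact transv_subproof u t : \det (transv_mx u t) == 1.
Proof. by apply/eqP; rewrite det_mx2; ring. Qed.

Definition transv u t : SL2 R := MkSL2 (transv_subproof u t).

Lemma mx_act_transv u t q : mx_act (transv u t) q = transv_vec u t q.
Proof.
by rewrite /mx_act /transv_vec /omega !mxE /=; congr pair; ring.
Qed.

Lemma transvM u s t : (transv u s * transv u t)%g = transv u (s + t).
Proof. by apply/val_inj; rewrite /= mul_mx2; congr mx2; ring. Qed.

Lemma transv0 u : transv u 0 = 1%g.
Proof. by apply/val_inj; rewrite /= mx2_scalar; congr mx2; ring. Qed.

Lemma transvV u t : (transv u t)^-1%g = transv u (- t).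
Proof.
by apply: (mulgI (transv u t)); rewrite mulgV transvM subrr transv0.
Qed.

(** A map preserving [omega] conjugates the transvection along [u] into the one along the image of
    [u]. This is why the moves on vectors do not change the group. *)
Lemma transvJ u t v s :
  (transv v s * transv u t * transv v (- s))%g = transv (transv_vec v s u) t.
Proof.
by apply/val_inj; rewrite /= !mul_mx2 /transv_vec /omega; congr mx2 => /=; ring.
Qed.

(** The values [t = 0, 1, 2] give the three traces that are tested for ellipticity. *)
Lemma tr_transv3 u v w t :
  \tr (transv u 1 * transv v 1 * transv w t)%g =
  2 - omega u v ^+ 2 - t * (omega v w ^+ 2 + omega w u ^+ 2
    - omega u v * omega v w * omega w u).
Proof. by rewrite /= !mul_mx2 mxtrace_mx2 /omega; ring. Qed.

End Transvections.

(** * Ping-pong *)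

Variant corner := CornerU | CornerV | CornerW.

Lemma corner_eqVneq (c d : corner) : c = d \/ d <> c.
Proof. by case: c d => -[]; solve [by left | by right]. Qed.

Section PingPong.
Variable R : realType.
Implicit Types q : R * R.

(** Here [x, y, z] are the pairings of three vectors in cyclic order, and [a, b, c] their pairings
    with [q]. In the rescaled coordinates [I] and [J] below, the [n]-th power of the middle
    transvection adds [n * rho * (J - I)] to both, with [rho >= 1]. This is far enough to give two
    numbers of opposite signs the same sign. *)
Lemma ping_pong_ineq (x y z a b c n : R) :
  x ^+ 2 + y ^+ 2 + z ^+ 2 <= x * y * z -> 0 < x * y * z ->
  y * a + z * b + x * c = 0 ->
  (a / y - b / z) * (b / z - c / x) <= -1 -> 1 <= n \/ n <= -1 ->
  1 <= ((a + n * x * b) / y - b / z) * (b / z - (c - n * y * b) / x)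
  /\ 4 <= b ^+ 2.
Proof.
move=> Sle P0 rel ijle n1.
have [x0 y0 z0] : [/\ x != 0, y != 0 & z != 0].
  by move: P0 => /lt0r_neq0; rewrite !mulf_eq0 !negb_or => /andP[/andP[-> ->] ->].
have S0 : 0 < x ^+ 2 + y ^+ 2 + z ^+ 2.
  by rewrite ltr_wpDr ?ltr_wpDr ?sqr_ge0 // lt0r sqrf_eq0 x0 sqr_ge0.
set S := _ + z ^+ 2 in Sle S0; have SN0 : S != 0 by rewrite gt_eqF.
set i := _ - _ in ijle; set j := _ - _ in ijle.
(* [D] is [b / z], found by solving [rel] in terms of [i] and [j]. *)
set D := (x ^+ 2 * j - y ^+ 2 * i) / S.
have bE : b = z * D.
  rewrite /D /i /j; apply: (mulIf SN0); rewrite mulrA divfK // /S.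
  have -> : c = - (y * a + z * b) / x by apply: (mulIf x0); rewrite divfK //; lra.
  by field; rewrite x0 y0 z0.
have aE : a = y * (i + D) by rewrite /i bE; field; rewrite y0 z0.
have cE : c = x * (D - j) by rewrite /j bE; field; rewrite x0 z0.
pose I := i * y / x; pose J := j * x / y; pose rho := x * y * z / S.
have IJ : I * J = i * j by rewrite /I /J; field; rewrite x0 y0.
have rho1 : 1 <= rho by rewrite /rho ler_pdivlMr // mul1r.
split; last first.
  have -> : b ^+ 2 = rho ^+ 2 * (J - I) ^+ 2.
    by rewrite bE /D /rho /I /J; field; rewrite SN0 x0 y0.
  have : 4 <= (J - I) ^+ 2.
    have -> : (J - I) ^+ 2 = (J + I) ^+ 2 - 4 * (i * j) by rewrite -IJ; ring.
    by have := sqr_ge0 (J + I); lra.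
  have : 1 <= rho ^+ 2 by rewrite expr_ge1 // (le_trans ler01).
  by set r2 := rho ^+ 2; set d2 := (J - I) ^+ 2; nra.
have -> : ((a + n * x * b) / y - b / z) * (b / z - (c - n * y * b) / x) =
    (I + n * rho * (J - I)) * (J + n * rho * (J - I)).
  by rewrite aE cE bE /D /rho /I /J; field; rewrite SN0 x0 y0 z0.
have : 1 <= n * rho \/ n * rho <= -1 by case: n1 => ?; [left|right]; nra.
rewrite -IJ in ijle; move: (n * rho) => N {n1 rho1}.
(* Since [I * J <= -1], the signs of [I] and [J] differ. The cases are the sign of [J] and the
   direction of the translation, whose length is at least that of [J - I]. *)
have [J0|J0] := leP 0 J; case=> N1.
- have I0 : I < 0 by nra.
  have h1 : J <= I + N * (J - I) by nra.
  have h2 : J - I <= J + N * (J - I) by nra.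
  by nra.
- have I0 : I < 0 by nra.
  have h1 : I + N * (J - I) <= I - (J - I) by nra.
  have h2 : J + N * (J - I) <= I by nra.
  by nra.
- have I0 : 0 < I by nra.
  have h1 : I + N * (J - I) <= J by nra.
  have h2 : J + N * (J - I) <= J - I by nra.
  by nra.
- have I0 : 0 < I by nra.
  have h1 : I - (J - I) <= I + N * (J - I) by nra.
  have h2 : I <= J + N * (J - I) by nra.
  by nra.
Qed.

(** * Ping-pong regions of the plane *)

Variables u v w : R * R.

Definition corner_vec c :=
  match c with CornerU => u | CornerV => v | CornerW => w end.

(* [wedge c q >= 1] are the ping-pong regions.  The weights are chosen so that the
   zeros of the three sides, which sum to 0, are z u - y v, x v - z w and
   y w - x u; if kappa = 0, then T_v^-1, T_w^-1 and T_u^-1 respectively map each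
   of these three lines to the next one. *)
Definition side (u v w : R * R) q :=
  omega u q / omega v w - omega v q / omega w u.

Definition wedge c q :=
  match c with
  | CornerU => side w u v q * side u v w q
  | CornerV => side u v w q * side v w u q
  | CornerW => side v w u q * side w u v q
  end.

Hypothesis kappa_le0 :
  omega u v ^+ 2 + omega v w ^+ 2 + omega w u ^+ 2
    <= omega u v * omega v w * omega w u.
Hypothesis omegas_gt0 : 0 < omega u v * omega v w * omega w u.

(** Any two wedges share a side, and because the sides sum to 0 these wedges add up to minus the
    square of that side. *)
Lemma wedge_disjoint c c' q : c <> c' -> 1 <= wedge c q -> wedge c' q <= -1.
Proof.
have : side u v w q + side v w u q + side w u v q = 0 by rewrite /side; ring.
rewrite /wedge; move: (side u v w q) (side v w u q) (side w u v q) => i j k.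
move=> e; have {e}-> : k = - (i + j) by lra.
case: c c' => -[] cc'; try by case: cc'.
all: by move=> h; nra.
Qed.

Lemma omega_transv_l (a b : R * R) t q :
  omega a (transv_vec b t q) = omega a q + t * omega a b * omega b q.
Proof. by rewrite /transv_vec /omega /=; ring. Qed.

Lemma omega_transv_r (a b : R * R) t q :
  omega a (transv_vec b t q) = omega a q - t * omega b a * omega b q.
Proof. by rewrite /transv_vec /omega /=; ring. Qed.

Lemma omegaxx (a : R * R) : omega a a = 0.
Proof. by rewrite /omega; ring. Qed.

Lemma side_ping_pong (a b c : R * R) q (n : int) :
  omega a b ^+ 2 + omega b c ^+ 2 + omega c a ^+ 2
    <= omega a b * omega b c * omega c a ->
  0 < omega a b * omega b c * omega c a ->
  side a b c q * side b c a q <= -1 -> n != 0 ->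
  1 <= side a b c (transv_vec b n%:~R q) * side b c a (transv_vec b n%:~R q)
  /\ 4 <= omega b q ^+ 2.
Proof.
move=> le0 gt0 farq n0; rewrite /side omega_transv_l (omega_transv_r c).
rewrite (omega_transv_l b) omegaxx mulr0 mul0r addr0.
apply: ping_pong_ineq => //; first by rewrite /omega; ring.
have [n1|] := leP 1 n; first by left; rewrite ler1z.
by move=> n1; right; rewrite -[-1]/((-1)%:~R) ler_int; move: n0 n1; lia.
Qed.

Lemma wedge_ping_pong c q (n : int) : wedge c q <= -1 -> n != 0 ->
  1 <= wedge c (transv_vec (corner_vec c) n%:~R q)
  /\ 4 <= omega (corner_vec c) q ^+ 2.
Proof.
case: c => /= far n0; apply: side_ping_pong => //; move: kappa_le0 omegas_gt0;
  by move: (omega u v) (omega v w) (omega w u) => x y z; lra.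
Qed.

Lemma wedge_corner c : wedge c (corner_vec c) = 1.
Proof.
move: omegas_gt0 => /lt0r_neq0; rewrite !mulf_eq0 !negb_or => /andP[/andP[x0 y0] z0].
have e1 : omega v u = - omega u v by rewrite /omega; ring.
have e2 : omega w v = - omega v w by rewrite /omega; ring.
have e3 : omega u w = - omega w u by rewrite /omega; ring.
case: c; rewrite /= /side !omegaxx ?e1 ?e2 ?e3 ?mul0r ?subr0 ?sub0r; field;
  by rewrite ?x0 ?y0 ?z0.
Qed.

(** Images of the three vectors under words with alternating letters. The index is the last letter
    applied, or the starting corner, and names the region that contains the vector. *)
Inductive corner_orbit : corner -> R * R -> Prop :=
| corner_orbit_base c : corner_orbit c (corner_vec c)
| corner_orbit_step c c' (n : int) q : c <> c' -> n != 0 ->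
    corner_orbit c' q -> corner_orbit c (transv_vec (corner_vec c) n%:~R q).

Lemma corner_orbit_wedge c q : corner_orbit c q -> 1 <= wedge c q.
Proof.
elim=> [{}c|{}c c' n {}q cc' n0 _ IH]; first by rewrite wedge_corner.
have far : wedge c q <= -1 by apply: wedge_disjoint IH => /esym.
by have [] := wedge_ping_pong far n0.
Qed.

(** If [c'] is not the last letter, [q] lies outside the region of [c'] and ping-pong bounds the
    pairing. Otherwise that letter can be removed, because a transvection preserves the pairing with
    its own vector. *)
Lemma corner_orbit_omega c c' q : corner_orbit c q ->
  omega (corner_vec c') q = 0 \/ 4 <= omega (corner_vec c') q ^+ 2.
Proof.
have main d q' : corner_orbit d q' -> c' <> d -> 4 <= omega (corner_vec c') q' ^+ 2.
  move=> dq' c'd; have far : wedge c' q' <= -1.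
    by apply: wedge_disjoint (corner_orbit_wedge dq') => /esym.
  by have [] := wedge_ping_pong (n := 1) far.
move=> cq; have [cc'|cc'] := corner_eqVneq c c'; last by right; exact: main cq _.
move: cc'; case: cq => [d <-|d d' n {}q dd' n0 d'q dc'].
  by left; rewrite omegaxx.
rewrite {}dc' in dd' *; rewrite omega_transv_l omegaxx mulr0 mul0r addr0.
by right; exact: main d'q _.
Qed.

Lemma transv_vecD (a : R * R) s t q :
  transv_vec a s (transv_vec a t q) = transv_vec a (s + t) q.
Proof. by rewrite /transv_vec /omega /=; congr pair; ring. Qed.

Lemma transv_vec0 (a : R * R) q : transv_vec a 0 q = q.
Proof. by case: q => ? ?; rewrite /transv_vec /=; congr pair; ring. Qed.

Lemma corner_orbit_transv c d q (n : int) : corner_orbit c q ->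
  exists c', corner_orbit c' (transv_vec (corner_vec d) n%:~R q).
Proof.
have [->|n0] := eqVneq n 0; first by rewrite transv_vec0; exists c.
have [<-|dc] := corner_eqVneq c d.
  case=> [{}c|{}c c' m {}q cc' m0 c'q].
    exists c; have -> : transv_vec (corner_vec c) n%:~R (corner_vec c) = corner_vec c.
      by case: (corner_vec c) => a b; rewrite /transv_vec /omega /=; congr pair; ring.
    exact: corner_orbit_base.
  rewrite transv_vecD -intrD; have [->|nm0] := eqVneq (n + m) 0.
    by rewrite transv_vec0; exists c'.
  by exists c; exact: corner_orbit_step c'q.
by move=> cq; exists d; exact: corner_orbit_step cq.
Qed.

End PingPong.

(** * Discreteness *)

Section TransvectionGroups.
Variable R : realType.
Implicit Types (u v w q : R * R) (M : 'M[R]_2).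

Definition transv_group u v w : set (PSL2 R) :=
  generated_subgroup
    [set \pi_(PSL2 R) (transv u 1); \pi_(PSL2 R) (transv v 1);
         \pi_(PSL2 R) (transv w 1)].

Lemma pi_mulg (A B : SL2 R) :
  (\pi_(PSL2 R) A * \pi_(PSL2 R) B)%g = \pi_(PSL2 R) (A * B)%g.
Proof. exact: PSL2_piM. Qed.

Lemma pi_invg (A : SL2 R) : ((\pi_(PSL2 R) A)^-1)%g = \pi_(PSL2 R) (A^-1)%g.
Proof. exact: PSL2_piV. Qed.

Lemma pi_eqP (A B : SL2 R) :
  \pi_(PSL2 R) A = \pi_(PSL2 R) B <->
  SL2_val A = SL2_val B \/ SL2_val A = - SL2_val B.
Proof. by split=> [/eqP/PSL2_eqP|/PSL2_eqP/eqP]. Qed.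

Lemma omegaNr u q : omega u (- q) = - omega u q.
Proof. by rewrite /omega /=; ring. Qed.

(** [omega q (mx_act M q)] is a quadratic form in [q] with coefficients [M 1 0], [M 1 1 - M 0 0] and
    [- M 0 1]. It vanishes on three distinct lines, hence identically; the witnesses given to
    [cramer] are the cofactors of this linear system. *)
Lemma scalar_of_three_fixed_lines u v w M :
  omega u v * omega v w * omega w u != 0 ->
  omega u (mx_act M u) = 0 -> omega v (mx_act M v) = 0 ->
  omega w (mx_act M w) = 0 -> M = (M 0 0)%:M.
Proof.
move=> D0 Mu Mv Mw; have cramer (c d e : R * R -> R) (a : R) :
    a * (omega u v * omega v w * omega w u) =
    c u * omega u (mx_act M u) + d v * omega v (mx_act M v)
    + e w * omega w (mx_act M w) -> a = 0.
  by rewrite Mu Mv Mw !mulr0 !addr0 => /eqP; rewrite mulf_eq0 (negPf D0) orbF => /eqP.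
have M10 : M 1 0 = 0.
  apply: (cramer (fun=> v.2 * w.2 * omega v w * -1)
    (fun=> w.2 * u.2 * omega w u * -1) (fun=> u.2 * v.2 * omega u v * -1)).
  by rewrite /omega /mx_act /=; ring.
have M01 : M 0 1 = 0.
  apply: (cramer (fun=> v.1 * w.1 * omega v w)
    (fun=> w.1 * u.1 * omega w u) (fun=> u.1 * v.1 * omega u v)).
  by rewrite /omega /mx_act /=; ring.
have M11 : M 1 1 - M 0 0 = 0.
  apply: (cramer (fun=> (v.1 * w.2 + v.2 * w.1) * omega v w)
    (fun=> (w.1 * u.2 + w.2 * u.1) * omega w u)
    (fun=> (u.1 * v.2 + u.2 * v.1) * omega u v)).
  by rewrite /omega /mx_act /=; ring.
by rewrite {1}(mx2P M) mx2_scalar M01 M10; congr mx2; exact: subr0_eq.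
Qed.

Lemma continuous_SL2_entry (i j : 'I_2) :
  continuous (fun A : SL2 R => (A : 'M[R]_2) i j).
Proof.
move=> A; apply: (@continuous_comp _ _ _ (@SL2_val R) (fun M : 'M[R]_2 => M i j)).
  exact: initial_continuous.
exact: coord_continuous.
Qed.

Lemma continuous_omega_act M u :
  continuous (fun A : SL2 R => omega u (mx_act (M *m A) u)).
Proof.
have -> : (fun A : SL2 R => omega u (mx_act (M *m A) u)) =
    (fun A : SL2 R =>
       (A : 'M[R]_2) 0 0 * ((u.1 * M 1 0 - u.2 * M 0 0) * u.1)
     + (A : 'M[R]_2) 0 1 * ((u.1 * M 1 0 - u.2 * M 0 0) * u.2)
     + (A : 'M[R]_2) 1 0 * ((u.1 * M 1 1 - u.2 * M 0 1) * u.1)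
     + (A : 'M[R]_2) 1 1 * ((u.1 * M 1 1 - u.2 * M 0 1) * u.2)).
  apply/funext => A; rewrite mx_actM /omega /mx_act /=; ring.
move=> A.
have cont i j k : {for A, continuous (fun B : SL2 R => (B : 'M[R]_2) i j * k)}.
  apply: (@continuousM _ _ _ (fun=> k)); first exact: continuous_SL2_entry.
  exact: cst_continuous.
exact: (continuousD (continuousD (continuousD (cont 0 0 _) (cont 0 1 _)) (cont 1 0 _))
  (cont 1 1 _)).
Qed.

Lemma discrete_transv_group u v w :
  omega u v ^+ 2 + omega v w ^+ 2 + omega w u ^+ 2
    <= omega u v * omega v w * omega w u ->
  0 < omega u v * omega v w * omega w u ->
  discrete_subgroup (transv_group u v w).
Proof.
move=> le0 gt0 g Gg.
(* Stability is a property of a matrix and may hold for only one of the two lifts of an element; the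
   squares in [phi] below absorb this sign. *)
pose stable (A : SL2 R) := forall c q, corner_orbit u v w c q ->
  exists c', corner_orbit u v w c' (mx_act A q).
have lift h : transv_group u v w h -> exists2 A, h = \pi_(PSL2 R) A & stable A.
  (* Stability of the inverse is included so that [H] is a subgroup. *)
  pose H : set (PSL2 R) :=
    [set h | exists A, [/\ h = \pi_(PSL2 R) A, stable A & stable A^-1%g]].
  suff GH : transv_group u v w `<=` H by move=> /GH[A [-> sA _]]; exists A.
  have stableM A B : stable A -> stable B -> stable (A * B)%g.
    move=> sA sB c q /sB[c' /sA[d dq]]; exists d.
    by rewrite mx_actM.
  apply: generated_sub; first split.
  - exists 1%g; rewrite invg1; split=> // c q cq; exists c;
      by rewrite mx_act1.
  - move=> _ _ [A [-> sA sAV]] [B [-> sB sBV]]; exists (A * B^-1)%g.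
    by rewrite pi_invg pi_mulg invgM invgK; split=> //; exact: stableM.
  - have sT d (n : int) : stable (transv (corner_vec u v w d) n%:~R).
      by move=> c q cq; rewrite mx_act_transv; exact: corner_orbit_transv cq.
    move=> _ [[->|->]|->]; [exists (transv u 1)|exists (transv v 1)
      |exists (transv w 1)]; rewrite transvV -(rmorphN1 intr) -[1](rmorph1 intr);
      split=> //; [exact: (sT CornerU)|exact: (sT CornerU)|exact: (sT CornerV)
      |exact: (sT CornerV)|exact: (sT CornerW)|exact: (sT CornerW)].
(* On the group each summand is 0 or at least 4, so [phi < 4] cuts out a neighbourhood of [g] on
   which all three summands vanish. *)
pose phi (A : SL2 R) :=
  omega u (mx_act (SL2_val ((repr g)^-1)%g *m A) u) ^+ 2 +
  omega v (mx_act (SL2_val ((repr g)^-1)%g *m A) v) ^+ 2 +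
  omega w (mx_act (SL2_val ((repr g)^-1)%g *m A) w) ^+ 2.
have phi_cont : continuous (phi \o repr : PSL2 R -> R).
  apply: repr_comp_continuous => [A|A B /PSL2_eqP[]AB]; last 2 first.
  - by rewrite /phi /= AB.
  - by rewrite /phi /= AB mulmxN !mx_actN !omegaNr !sqrrN.
  have cont e : {for A, continuous (fun B : SL2 R =>
      omega e (mx_act (SL2_val ((repr g)^-1)%g *m B) e) ^+ 2)}.
    by apply: continuousM; exact: continuous_omega_act.
  exact: (continuousD (continuousD (cont u) (cont v)) (cont w)).
split; first by rewrite inE.
exists [set x | (phi \o repr) x < 4].
  apply: open_nbhs_nbhs; split; last first.
    rewrite /= /phi -[_ *m _]/(SL2_val ((repr g)^-1 * repr g)%g) mulVg !mx_act1.
    by rewrite !omegaxx expr0n !addr0.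
  by move/continuousP: phi_cont => /(_ [set r | r < 4]); apply; exact: open_lt.
apply/seteqP; split=> [x [/= x4 Gx]|_ ->]; last first.
  split=> //=; rewrite /phi -[_ *m _]/(SL2_val ((repr g)^-1 * repr g)%g) mulVg.
  by rewrite !mx_act1 !omegaxx expr0n !addr0.
set B := ((repr g)^-1 * repr x)%g in x4.
have [A hA sA] : exists2 A, (g^-1 * x)%g = \pi_(PSL2 R) A & stable A.
  have sG := subgroup_generated
    [set \pi_(PSL2 R) (transv u 1); \pi_(PSL2 R) (transv v 1);
         \pi_(PSL2 R) (transv w 1)].
  by apply: lift; apply: (subgroupM sG) => //; exact: (subgroupV sG).
have AB : SL2_val B = A \/ SL2_val B = - SL2_val A.
  by apply/pi_eqP; rewrite -hA /B -pi_mulg -pi_invg !reprK.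
have eA e : omega e (mx_act B e) ^+ 2 = omega e (mx_act A e) ^+ 2.
  by case: AB => ->; rewrite // mx_actN omegaNr sqrrN.
have x4' : omega u (mx_act A u) ^+ 2 + omega v (mx_act A v) ^+ 2 +
    omega w (mx_act A w) ^+ 2 < 4 by rewrite -!eA.
have A0 c : omega (corner_vec u v w c) (mx_act A (corner_vec u v w c)) ^+ 2 < 4 ->
    omega (corner_vec u v w c) (mx_act A (corner_vec u v w c)) = 0.
  have [c' c'q] := sA c _ (corner_orbit_base u v w c).
  by have [//|] := corner_orbit_omega le0 gt0 c c'q; rewrite leNgt => /negPf->.
have hu := sqr_ge0 (omega u (mx_act A u)).
have hv := sqr_ge0 (omega v (mx_act A v)).
have hw := sqr_ge0 (omega w (mx_act A w)).
have Au : omega u (mx_act A u) = 0 by apply: (A0 CornerU) => /=; lra.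
have Av : omega v (mx_act A v) = 0 by apply: (A0 CornerV) => /=; lra.
have Aw : omega w (mx_act A w) = 0 by apply: (A0 CornerW) => /=; lra.
have As := scalar_of_three_fixed_lines (lt0r_neq0 gt0) Au Av Aw.
have : (SL2_val A 0 0) ^+ 2 = 1.
  by have := SL2_det A; rewrite As det_scalar mxE mulr1n.
move/eqP; rewrite sqrf_eq1 => A1.
have : (g^-1 * x)%g = 1%g.
  rewrite hA -[RHS]/(\pi_(PSL2 R) 1%g); apply/pi_eqP; rewrite As.
  case/orP: A1 => /eqP->; [by left|right].
  by rewrite /= -[RHS]scaleN1r scalemx1.
by move=> /(canRL (mulKVg _)); rewrite mulg1.
Qed.

End TransvectionGroups.

(** * Moves, and gaps in the absence of elliptic elements *)

Section Descent.
Variable R : realType.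
Implicit Types (u v w : R * R) (p q r s : R).

Lemma generated_eq (G : groupType) (S T : set G) :
  S `<=` generated_subgroup T -> T `<=` generated_subgroup S ->
  generated_subgroup S = generated_subgroup T.
Proof.
by move=> ST TS; apply/seteqP; split; apply: generated_sub => //;
  exact: subgroup_generated.
Qed.

Lemma transv_group_rot u v w : transv_group u v w = transv_group v w u.
Proof.
by rewrite /transv_group -setUA setUC.
Qed.

Lemma transv_group_swap u v w : transv_group u v w = transv_group v u w.
Proof. by rewrite /transv_group (setUC [set \pi_(PSL2 R) (transv u 1)]). Qed.

Lemma subgroup_transv_group u v w : subgroup (transv_group u v w).
Proof. exact: subgroup_generated. Qed.

Lemma mem_transv_group u v w :
  [/\ transv_group u v w (\pi_(PSL2 R) (transv u 1)),
      transv_group u v w (\pi_(PSL2 R) (transv v 1)) &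
      transv_group u v w (\pi_(PSL2 R) (transv w 1))].
Proof.
by split; apply: sub_generated; [left; left|left; right|right].
Qed.

Lemma transv_group_slide u v w (e : bool) :
  transv_group u v (transv_vec v ((-1) ^+ e) w) = transv_group u v w.
Proof.
have pm (G : set (PSL2 R)) (b : bool) : subgroup G ->
    G (\pi_(PSL2 R) (transv v 1)) -> G (\pi_(PSL2 R) (transv v ((-1) ^+ b))).
  move=> sG Gv; case: b => /=; last by rewrite expr0.
  by rewrite expr1 -transvV -pi_invg; exact: subgroupV.
have slide w' (b : bool) : transv_group u v w'
    (\pi_(PSL2 R) (transv (transv_vec v ((-1) ^+ b) w') 1)).
  have sG := subgroup_transv_group u v w'; have [_ Gv Gw] := mem_transv_group u v w'.
  rewrite -transvJ -!pi_mulg; apply: (subgroupM sG); last first.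
    have -> : - (-1) ^+ b = (-1) ^+ (~~ b) :> R.
      by case: b; rewrite /= ?expr1 ?expr0 ?opprK.
    exact: (pm _ _ sG).
  by apply: (subgroupM sG) => //; exact: (pm _ _ sG).
apply: generated_eq => g [[->|->]|->].
- by have [] := mem_transv_group u v w.
- by have [] := mem_transv_group u v w.
- exact: slide.
- by have [] := mem_transv_group u v (transv_vec v ((-1) ^+ e) w).
- by have [] := mem_transv_group u v (transv_vec v ((-1) ^+ e) w).
(* The slide of opposite sign undoes the move. *)
- have := slide (transv_vec v ((-1) ^+ e) w) (~~ e).
  by rewrite transv_vecD signrN addNr transv_vec0.
Qed.

(** Only the absolute value of [s] is recorded: exchanging two of the vectors keeps the group but
    reverses the sign of the triple product. *)
Definition invariants (G : set (PSL2 R)) p q r s := exists u v w,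
  [/\ G = transv_group u v w, p = omega u v ^+ 2, q = omega v w ^+ 2,
      r = omega w u ^+ 2 & `|s| = `|omega u v * omega v w * omega w u| ].

Lemma invariants_rot G p q r s : invariants G p q r s -> invariants G q r p s.
Proof.
move=> [u [v [w [-> -> -> -> sE]]]]; exists v, w, u; split=> //.
  exact: transv_group_rot.
by rewrite sE; congr `|_|; ring.
Qed.

(** The exponent of [T_v] is the sign of the triple product, so that [omega u v * omega v w] is
    subtracted from [omega w u] in absolute value. *)
Lemma invariants_slide G p q r s : invariants G p q r s ->
  invariants G p q (r + p * q - 2 * `|s|) (`|s| - p * q).
Proof.
move=> [u [v [w [-> -> -> -> ->]]]].
set P := omega u v * omega v w * omega w u.
exists u, v, (transv_vec v ((-1) ^+ (P < 0)%R) w).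
have e1 : omega v (transv_vec v ((-1) ^+ (P < 0)%R) w) = omega v w.
  by rewrite omega_transv_l omegaxx mulr0 mul0r addr0.
have e2 : omega (transv_vec v ((-1) ^+ (P < 0)%R) w) u =
    omega w u - (-1) ^+ (P < 0)%R * omega u v * omega v w.
  by rewrite /transv_vec /omega /=; ring.
rewrite e1 e2 transv_group_slide; split=> //; rewrite /P.
  by case: ltrP => hP; rewrite /= ?expr0 ?expr1 ?(ger0_norm hP) ?(ltr0_norm hP); ring.
case: ltrP => hP; rewrite /= ?expr0 ?expr1 ?(ger0_norm hP) ?(ltr0_norm hP).
  by rewrite -normrN; congr `|_|; ring.
by congr `|_|; ring.
Qed.

(** * Consequences of freeness and of the absence of elliptic elements *)

Lemma transv_comm u v : omega u v = 0 ->
  (transv u 1 * transv v 1 = transv v 1 * transv u 1)%g.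
Proof.
move=> uv0; apply/val_inj; rewrite /= !mul_mx2.
have [e1 e2 e3 e4] : [/\ omega u v * (u.1 * v.2 + v.1 * u.2) = 0,
    omega u v * (2 * u.1 * v.1) = 0, omega u v * (2 * u.2 * v.2) = 0 &
    u.1 * v.2 = u.2 * v.1].
  by rewrite uv0 !mul0r; split=> //; apply/eqP; rewrite -subr_eq0 -/(omega u v) uv0.
move: e1 e2 e3; rewrite /omega => e1 e2 e3; congr mx2; lra.
Qed.

Lemma omega_neq0 u v w : free_of_rank 3 (transv_group u v w) -> omega u v != 0.
Proof.
move=> free; apply/eqP => uv0; apply: (free_generators_noncomm free (erefl _)).
by rewrite !pi_mulg transv_comm.
Qed.

Lemma omegas_neq0 u v w : free_of_rank 3 (transv_group u v w) ->
  omega u v * omega v w * omega w u != 0.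
Proof.
move=> free; have := free; rewrite transv_group_rot => free1.
have := free1; rewrite transv_group_rot => free2.
by rewrite !mulf_neq0 ?(omega_neq0 free) ?(omega_neq0 free1) ?(omega_neq0 free2).
Qed.

Lemma elliptic_of_trace (A : SL2 R) : `|\tr A| < 2 -> elliptic (\pi_(PSL2 R) A).
Proof.
move=> trA; split; last by rewrite abs_trace_pi.
rewrite -[1%g]/(\pi_(PSL2 R) 1%g) => /pi_eqP A1; move: trA.
by case: A1 => ->; rewrite ?linearN ?normrN /= mxtrace1 ger0_norm ?ltxx.
Qed.

(** Together with the first generator, the product of the first two and the third again generate the
    group, so no two of them commute. *)
Lemma product_noncomm u v w : free_of_rank 3 (transv_group u v w) ->
  (transv u 1 * transv v 1 * transv w 1 <>
   transv w 1 * (transv u 1 * transv v 1))%g.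
Proof.
move=> free e.
pose a := \pi_(PSL2 R) (transv u 1); pose b := \pi_(PSL2 R) (transv v 1).
pose c := \pi_(PSL2 R) (transv w 1).
have [Ga Gb Gc] := mem_transv_group u v w.
have gen : transv_group u v w = generated_subgroup [set a * b; c; a]%g.
  have sS := subgroup_generated [set a * b; c; a]%g.
  have Sa : generated_subgroup [set a * b; c; a]%g a by apply: sub_generated; right.
  apply: generated_eq => g [[->|->]|->] //.
  - have Sab : generated_subgroup [set a * b; c; a]%g (a * b)%g.
      by apply: sub_generated; left; left.
    by have := subgroupM sS (subgroupV sS Sa) Sab; rewrite mulKg.
  - by apply: sub_generated; left; right.
  - exact: (subgroupM (subgroup_transv_group u v w)).
apply: (free_generators_noncomm free gen).
by rewrite /a /b /c !pi_mulg e.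
Qed.

Lemma transv_opp u (t : R) : transv (- u) t = transv u t.
Proof. by apply/val_inj; congr mx2 => /=; ring. Qed.

(* If kappa = 4, then T_u T_v T_w ^ 2 has trace x ^ 2 - 6, which makes it
   elliptic when 4 < x ^ 2 < 8.  If moreover x ^ 2 = 4, then - w is the image of
   w under T_u T_v, so that T_u T_v commutes with T_w. *)
Lemma oriented_gaps u v w (x := omega u v) (y := omega v w) (z := omega w u)
    (k := x ^+ 2 + y ^+ 2 + z ^+ 2 - x * y * z) :
  (forall g, transv_group u v w g -> ~ elliptic g) ->
  free_of_rank 3 (transv_group u v w) -> 0 < x * y * z ->
  [/\ 4 <= x ^+ 2, k <= 0 \/ 4 <= k & k = 4 -> 8 <= x ^+ 2].
Proof.
move=> noell free P0.
have sG := subgroup_transv_group u v w.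
have [Ga Gb Gc] := mem_transv_group u v w.
have Gabc n : transv_group u v w
    (\pi_(PSL2 R) (transv u 1 * transv v 1 * transv w n%:R)%g).
  rewrite -!pi_mulg; apply: (subgroupM sG); first exact: (subgroupM sG).
  elim: n => [|n IH]; first by rewrite transv0; exact: (proj1 sG).
  by rewrite -natr1 -transvM -pi_mulg; exact: (subgroupM sG).
have x4 : 4 <= x ^+ 2.
  rewrite leNgt; apply/negP => x4; apply: (noell _ (Gabc 0)); apply: elliptic_of_trace.
  rewrite tr_transv3 mul0r subr0 -/x ltr_norml.
  have : 0 < x ^+ 2 by rewrite lt0r sqr_ge0 sqrf_eq0 (omega_neq0 free).
  by move=> ?; apply/andP; split; lra.
split=> // [|k4].
  have [|k0] := leP k 0; first by left.
  right; rewrite leNgt; apply/negP => k4; apply: (noell _ (Gabc 1)).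
  apply: elliptic_of_trace; rewrite tr_transv3 -/x -/y -/z ltr_norml.
  by apply/andP; move: k0 k4; rewrite /k; split; lra.
rewrite leNgt; apply/negP => x8.
have [xE|x4'] := eqVneq (x ^+ 2) 4; last first.
  have {x4' x4}x4 : 4 < x ^+ 2 by rewrite lt_neqAle eq_sym x4' x4.
  apply: (noell _ (Gabc 2)); apply: elliptic_of_trace; rewrite tr_transv3 -/x -/y -/z.
  by rewrite ltr_norml; apply/andP; move: k4; rewrite /k; split; lra.
(* For [k = 4] and [x ^+ 2 = 4], the equation for [k] becomes a perfect square in [z]. *)
have zE : z = x * y / 2.
  apply/eqP; rewrite -subr_eq0 -sqrf_eq0; apply/eqP.
  have -> : (z - x * y / 2) ^+ 2 = k - x ^+ 2 - (1 - x ^+ 2 / 4) * y ^+ 2.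
    by rewrite /k; field.
  by rewrite k4 xE; field.
apply: (product_noncomm free); set M := (transv u 1 * transv v 1)%g.
have : (M * transv w 1 * M^-1)%g = transv w 1.
  rewrite /M invgM !transvV !mulgA -(mulgA (transv u 1)) -(mulgA (transv u 1)).
  rewrite !transvJ -[RHS]transv_opp; congr transv.
  have x0 : x != 0 := omega_neq0 free.
  (* Coordinates of the linear relation between three vectors of the plane; they are used to see
     that [M] maps [w] to [- w], which has the same transvection. *)
  have w1 : x * w.1 = - (y * u.1 + z * v.1) by rewrite /x /y /z /omega; ring.
  have w2 : x * w.2 = - (y * u.2 + z * v.2) by rewrite /x /y /z /omega; ring.
  have uTw : omega u (transv_vec v 1 w) = z.
    rewrite omega_transv_l -/x -/y.
    have -> : omega u w = - z by rewrite /z /omega; ring.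
    by rewrite zE; field.
  rewrite {1}/transv_vec uTw /transv_vec -/y /= [RHS]surjective_pairing /=.
  have z2 a : 2 * z * a = x * y * a by rewrite zE; field.
  have xz a : x * z * a = 2 * y * a.
    have -> : x * z * a = x ^+ 2 / 2 * y * a by rewrite zE; field.
    by rewrite xE; field.
  congr pair; apply: (mulfI x0).
    by have := xz u.1; have := z2 v.1; lra.
  by have := xz u.2; have := z2 v.2; lra.
by move=> e; rewrite -[in RHS]e -!mulgA mulVg mulg1.
Qed.

End Descent.

(** * Termination of the descent *)

Section Termination.
Variable R : realType.
Implicit Types (u v w : R * R) (p q r s X Y Z : R).

Lemma markov_gaps (G : set (PSL2 R)) p q r s (k := p + q + r - `|s|) :
  (forall g, G g -> ~ elliptic g) -> free_of_rank 3 G -> invariants G p q r s ->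
  [/\ `|s| = Num.sqrt p * Num.sqrt q * Num.sqrt r,
      [/\ 4 <= p, 4 <= q & 4 <= r], k <= 0 \/ 4 <= k &
      k = 4 -> [/\ 8 <= p, 8 <= q & 8 <= r] ].
Proof.
move=> noell free [u [v [w [GE pE qE rE sE]]]].
(* Exchanging [u] and [v] reverses the sign of the triple product; the gaps for the other two
   pairings then come from cyclic rotation. *)
wlog P0 : p q r s u v w @k GE pE qE rE sE / 0 < omega u v * omega v w * omega w u.
  move=> wlog; have freeG := free; rewrite GE in freeG; have := omegas_neq0 freeG.
  rewrite neq_lt => /orP[P0|]; last exact: wlog.
  have e (a b : R * R) : omega a b = - omega b a by rewrite /omega; ring.
  have := wlog p r q s v u w; rewrite -transv_group_swap.
  rewrite (e v u) (e u w) (e w v) !mulNr !mulrN !mulNr !opprK !sqrrN normrN.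
  rewrite (mulrAC (omega u v)) oppr_gt0 (mulrAC (Num.sqrt p)) (addrAC p).
  case=> // h1 [h2 h3 h4] h5 h6; split=> // /h6[]; by [].
have freeG := free; have noellG := noell; rewrite GE in freeG noellG.
have [x4 k4 kx] := oriented_gaps noellG freeG P0.
rewrite !(transv_group_rot u) in freeG noellG.
have Pv : 0 < omega v w * omega w u * omega u v by rewrite mulrC mulrA.
have [y4 _ ky] := oriented_gaps noellG freeG Pv.
rewrite !(transv_group_rot v) in freeG noellG.
have Pw : 0 < omega w u * omega u v * omega v w by rewrite mulrC mulrA.
have [z4 _ kz] := oriented_gaps noellG freeG Pw.
have kE : k = omega u v ^+ 2 + omega v w ^+ 2 + omega w u ^+ 2 -
    omega u v * omega v w * omega w u by rewrite /k pE qE rE sE gtr0_norm.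
rewrite kE pE qE rE; split=> //.
  by rewrite sE !sqrtr_sqr !normrM.
move=> k0; split; first exact: kx.
  by apply: ky; rewrite -k0; ring.
by apply: kz; rewrite -k0; ring.
Qed.

(** The test [p * q < 4 * r] says that [2 |z|] exceeds [|x y|], which is when replacing [|z|] by
    [||z| - |x y||] is a decrease, for nonzero [x y]. The last branch has no test: without elliptic
    elements its move does decrease, and in any case the group is unchanged. *)
Definition slide_state (st : R * R * R * R) : R * R * R * R :=
  let: (p, q, r, s) := st in
  if p * q < 4 * r then (p, q, r + p * q - 2 * `|s|, `|s| - p * q)
  else if q * r < 4 * p then (p + q * r - 2 * `|s|, q, r, `|s| - q * r)
  else (p, q + r * p - 2 * `|s|, r, `|s| - r * p).

Definition height (st : R * R * R * R) : R :=
  let: (p, q, r, s) := st in Num.sqrt p + Num.sqrt q + Num.sqrt r.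

Definition kappa (st : R * R * R * R) : R :=
  let: (p, q, r, s) := st in p + q + r - `|s|.

Definition has_invariants (G : set (PSL2 R)) (st : R * R * R * R) :=
  let: (p, q, r, s) := st in invariants G p q r s.

(** If [Z] exceeds [X * Y], the gain is [X * Y >= 4]. Otherwise it is [2 * Z - X * Y], whose square
    is given by [dE]; for [k = 4] the bounds by 8 make that square at least 16. *)
Lemma slide_descent X Y Z (k := X ^+ 2 + Y ^+ 2 + Z ^+ 2 - X * Y * Z) :
  2 <= X -> 2 <= Y -> 2 <= Z -> 4 <= k ->
  (k = 4 -> 8 <= X ^+ 2 /\ 8 <= Y ^+ 2) -> X * Y < 2 * Z ->
  `|Z - X * Y| <= Z - 4 \/
  [/\ Z <= X * Y, 4 < k & `|Z - X * Y| <= Z - 2 * Num.sqrt (k - 4)].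
Proof.
move=> X2 Y2 Z2 k4 k8 XYZ.
have dE : (2 * Z - X * Y) ^+ 2 = (X ^+ 2 - 4) * (Y ^+ 2 - 4) + 4 * (k - 4).
  by rewrite /k; ring.
have [ZXY|ZXY] := leP Z (X * Y); last by left; rewrite gtr0_norm ?subr_gt0 //; nra.
rewrite ler0_norm ?subr_le0 //; move: k4; rewrite le_eqVlt => /orP[/eqP k4|k4].
  left; have [X8 Y8] := k8 (esym k4).
  have : 4 ^+ 2 <= (2 * Z - X * Y) ^+ 2 by rewrite dE -k4; nra.
  by rewrite ler_pXn2r ?nnegrE //; lra.
right; split=> //.
suff : 2 * Num.sqrt (k - 4) <= 2 * Z - X * Y by lra.
have s0 : 0 <= 2 * Num.sqrt (k - 4) by rewrite mulr_ge0 ?sqrtr_ge0.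
have d0 : 0 <= 2 * Z - X * Y by lra.
rewrite -(@ler_pXn2r _ 2) ?nnegrE //.
rewrite dE exprMn sqr_sqrtr; last by lra.
have : 0 <= (X ^+ 2 - 4) * (Y ^+ 2 - 4) by apply: mulr_ge0; nra.
by lra.
Qed.

(** A move of the largest coordinate always decreases it. Otherwise, with
    [X <= Y <= Z <= X * Y / 2], lowering [Z] to [Y] and then [Y] to [X] can only increase [k], so
    [4 <= k <= X ^+ 2 * (3 - X)]. This forces [X = 2] and [k = 4], which [k8] excludes. *)
Lemma slide_exists X Y Z (k := X ^+ 2 + Y ^+ 2 + Z ^+ 2 - X * Y * Z) :
  2 <= X -> 2 <= Y -> 2 <= Z -> 4 <= k ->
  (k = 4 -> 8 <= X ^+ 2 /\ 8 <= Y ^+ 2) ->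
  X <= Z -> Y <= Z -> X * Y < 2 * Z.
Proof.
wlog XY : X Y @k / X <= Y => [wlog|] X2 Y2 Z2 k4 k8 XZ YZ.
  have [|/ltW YX] := leP X Y; first by move=> XY; exact: wlog.
  rewrite mulrC; apply: wlog => //; rewrite -/k (mulrC Y) (addrC (Y ^+ 2)) // => /k8.
  by case.
rewrite ltNge; apply/negP => ZXY.
have h1 : k <= X ^+ 2 * (3 - X).
  have : (Z - Y) * (X * Y - Z - Y) >= 0 by apply: mulr_ge0; nra.
  have : (X - 2) * (Y ^+ 2 - X ^+ 2) >= 0 by apply: mulr_ge0; nra.
  by rewrite /k; lra.
have h2 : (X - 2) ^+ 2 * (X + 1) <= 0 by lra.
have X20 : X = 2.
  apply/eqP; rewrite -subr_eq0 -sqrf_eq0 eq_le sqr_ge0 andbT.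
  by have := sqr_ge0 (X - 2); nra.
have k4' : k = 4 by apply/eqP; rewrite eq_le k4 andbT (le_trans h1) // X20; lra.
by have [] := k8 k4'; rewrite X20; lra.
Qed.

Lemma slide_state_invariants (G : set (PSL2 R)) st :
  has_invariants G st -> has_invariants G (slide_state st).
Proof.
case: st => [[[p q] r] s] /= inv; case: ifP => _ /=; first exact: invariants_slide.
case: ifP => _ /=.
  by do 2!apply: invariants_rot; apply: invariants_slide; exact: invariants_rot.
by apply: invariants_rot; apply: invariants_slide; do 2!apply: invariants_rot.
Qed.

Lemma slide_r_descent (G : set (PSL2 R)) p q r s (k := p + q + r - `|s|)
    (r' := r + p * q - 2 * `|s|) (s' := `|s| - p * q) :
  (forall g, G g -> ~ elliptic g) -> free_of_rank 3 G -> invariants G p q r s ->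
  0 < k -> p * q < 4 * r ->
  Num.sqrt r' <= Num.sqrt r - 4 \/
  [/\ p + q + r' - `|s'| = k, 4 < k &
      Num.sqrt r' <= Num.sqrt r - 2 * Num.sqrt (k - 4)].
Proof.
move=> noell free inv k0 pq4r.
have [sE [p4 q4 r4] [|k4] k8] := markov_gaps noell free inv.
  by move=> kle; move: k0; rewrite ?/k; lra.
have sqrt_ge2 (a : R) : 4 <= a -> 2 <= Num.sqrt a.
  move=> a4; rewrite -(@ler_pXn2r _ 2) ?nnegrE ?sqrtr_ge0 //.
  by rewrite sqr_sqrtr; lra.
move: k0 k4 k8; rewrite /r' /s' /k {r' s' k inv}; rewrite sE.
have [pE qE rE] : [/\ p = Num.sqrt p ^+ 2, q = Num.sqrt q ^+ 2 & r = Num.sqrt r ^+ 2].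
  by rewrite !sqr_sqrtr //; lra.
move: pq4r (sqrt_ge2 _ p4) (sqrt_ge2 _ q4) (sqrt_ge2 _ r4); rewrite {p4 q4 r4 sqrt_ge2 sE}.
move: (Num.sqrt p) (Num.sqrt q) (Num.sqrt r) pE qE rE => X Y Z -> -> ->.
move=> pq4r X2 Y2 Z2 k0 k4 k8.
have XYZ : X * Y < 2 * Z.
  rewrite -(@ltr_pXn2r _ 2) ?nnegrE ?exprMn //; last 2 first.
  - by rewrite mulr_ge0 //; lra.
  - by lra.
  by lra.
have -> : Z ^+ 2 + X ^+ 2 * Y ^+ 2 - 2 * (X * Y * Z) = (Z - X * Y) ^+ 2 by ring.
rewrite sqrtr_sqr.
have k8' : X ^+ 2 + Y ^+ 2 + Z ^+ 2 - X * Y * Z = 4 -> 8 <= X ^+ 2 /\ 8 <= Y ^+ 2.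
  by move=> /k8[].
have [?|[ZXY k4' dec]] := slide_descent X2 Y2 Z2 k4 k8' XYZ; first by left.
right; split=> //; rewrite ler0_norm; last first.
  have -> : X * Y * Z - X ^+ 2 * Y ^+ 2 = X * Y * (Z - X * Y) by ring.
  by rewrite mulr_ge0_le0 ?subr_le0 // mulr_ge0 //; lra.
by ring.
Qed.

Lemma slide_r_exists (G : set (PSL2 R)) p q r s :
  (forall g, G g -> ~ elliptic g) -> free_of_rank 3 G -> invariants G p q r s ->
  0 < p + q + r - `|s| ->
  p <= r -> q <= r -> p * q < 4 * r.
Proof.
move=> noell free inv k0 pr qr.
have [sE [p4 q4 r4] [|k4] k8] := markov_gaps noell free inv.
  by move=> kle; move: k0; rewrite ?/k; lra.
have sqrt_ge2 (a : R) : 4 <= a -> 2 <= Num.sqrt a.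
  move=> a4; rewrite -(@ler_pXn2r _ 2) ?nnegrE ?sqrtr_ge0 //.
  by rewrite sqr_sqrtr; lra.
have XZ : Num.sqrt p <= Num.sqrt r by rewrite ler_wsqrtr.
have YZ : Num.sqrt q <= Num.sqrt r by rewrite ler_wsqrtr.
have [pE qE rE] : [/\ p = Num.sqrt p ^+ 2, q = Num.sqrt q ^+ 2 & r = Num.sqrt r ^+ 2].
  by rewrite !sqr_sqrtr //; lra.
move: (sqrt_ge2 _ p4) (sqrt_ge2 _ q4) (sqrt_ge2 _ r4) XZ YZ k4 k8.
rewrite {p4 q4 r4 sqrt_ge2 pr qr k0} sE.
move: (Num.sqrt p) (Num.sqrt q) (Num.sqrt r) pE qE rE => X Y Z -> -> ->.
move=> X2 Y2 Z2 XZ YZ k4 k8.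
have : X * Y < 2 * Z by apply: slide_exists => // /k8[].
rewrite -(@ltr_pXn2r _ 2) ?nnegrE ?exprMn //; last 2 first.
- by rewrite mulr_ge0 //; lra.
- by lra.
by lra.
Qed.

Lemma slide_state_descent (G : set (PSL2 R)) st :
  (forall g, G g -> ~ elliptic g) -> free_of_rank 3 G -> has_invariants G st ->
  0 < kappa st ->
  height (slide_state st) <= height st - 4 \/
  [/\ kappa (slide_state st) = kappa st, 4 < kappa st &
      height (slide_state st) <= height st - 2 * Num.sqrt (kappa st - 4)].
Proof.
move=> noell free; case: st => [[[p q] r] s] /= inv k0.
have inv1 := invariants_rot inv; have inv2 := invariants_rot inv1.
have k1 : 0 < q + r + p - `|s| by lra.
have k2 : 0 < r + p + q - `|s| by lra.
case: ifP => [c0|/negbT]; last first.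
  rewrite -leNgt => c0; case: ifP => [c1|/negbT]; last first.
    (* The largest coordinate admits a decreasing move; as the first two tests failed, the third
       inequality must hold. *)
    rewrite -leNgt => c1; have c2 : r * p < 4 * q.
      have [pr|rp] := leP p r; last first.
        have [qp|pq] := leP q p; last by apply: slide_r_exists inv2 _ _ _ => //; lra.
        have := slide_r_exists noell free inv1 k1 qp (ltW rp); lra.
      have [qr|rq] := leP q r.
        by have := slide_r_exists noell free inv k0 pr qr; lra.
      by apply: slide_r_exists inv2 _ _ _ => //; lra.
    have := slide_r_descent noell free inv2 k2 c2; rewrite /kappa /=.
    have -> : r + p + q - `|s| = p + q + r - `|s| by ring.
    by case=> [|[e k4]]; [left|right; split=> //]; lra.
  have := slide_r_descent noell free inv1 k1 c1; rewrite /kappa /=.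
  have -> : q + r + p - `|s| = p + q + r - `|s| by ring.
  by case=> [|[e k4]]; [left|right; split=> //]; lra.
have := slide_r_descent noell free inv k0 c0; rewrite /kappa /=.
by case=> [|[e k4]]; [left|right; split=> //]; lra.
Qed.

Lemma height_ge0 st : 0 <= height st.
Proof. by case: st => [[[p q] r] s]; rewrite /= !addr_ge0 ?sqrtr_ge0. Qed.

(** Two nested inductions: the outer one counts gains of 4. The inner one counts gains of [d], which
    is a fixed positive number as long as [kappa] is preserved; a gain of 4 may change [kappa] but
    returns to the outer induction. *)
Lemma slide_state_terminates (G : set (PSL2 R)) st :
  (forall g, G g -> ~ elliptic g) -> free_of_rank 3 G -> has_invariants G st ->
  exists n, kappa (iter n slide_state st) <= 0.
Proof.
move=> noell free.
have main N st' : has_invariants G st' -> height st' < N%:R * 4 ->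
    exists n, kappa (iter n slide_state st') <= 0.
  elim: N st' => [|N IH] {}st inv hN.
    by have := height_ge0 st; rewrite leNgt; move: hN; rewrite mul0r => ->.
  have next st' : (exists n, kappa (iter n slide_state (slide_state st')) <= 0) ->
      exists n, kappa (iter n slide_state st') <= 0.
    by move=> [n nP]; exists n.+1; rewrite iterSr.
  pose d := 2 * Num.sqrt (kappa st - 4).
  suff inner n st' : kappa st' = kappa st -> has_invariants G st' ->
      height st' < N.+1%:R * 4 -> 0 < d -> height st' < n%:R * d ->
      exists n, kappa (iter n slide_state st') <= 0.
    have [k0|k0] := leP (kappa st) 0; first by exists 0.
    have [h4|[_ k4 _]] := slide_state_descent noell free inv k0.
      apply/next/IH; first exact: slide_state_invariants.
      by move: hN; rewrite -natr1; lra.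
    have d0 : 0 < d by rewrite mulr_gt0 // sqrtr_gt0 subr_gt0.
    apply: (inner (Num.bound (height st / d)) st) => //.
    rewrite -ltr_pdivrMr //; apply: archi_boundP.
    by rewrite divr_ge0 ?height_ge0 // ltW.
  elim: n st' => [|n IHn] st' kst inv' h'N d0 hn.
    by have := height_ge0 st'; rewrite leNgt; move: hn; rewrite mul0r => ->.
  have [k0|k0] := leP (kappa st') 0; first by exists 0.
  apply: next; have inv'' := slide_state_invariants inv'.
  have [h4|[k' _ hd]] := slide_state_descent noell free inv' k0.
    by apply: IH => //; move: h'N; rewrite -natr1; lra.
  rewrite kst -/d in hd; apply: IHn => //; first by rewrite k'.
    by lra.
  by move: hn; rewrite -natr1; lra.
move=> inv; apply: (main (Num.bound (height st / 4)) st) => //.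
rewrite -ltr_pdivrMr //; apply: archi_boundP.
by rewrite divr_ge0 ?height_ge0.
Qed.

Lemma discrete_of_kappa_le0 (G : set (PSL2 R)) st :
  free_of_rank 3 G -> has_invariants G st -> kappa st <= 0 -> discrete_subgroup G.
Proof.
case: st => [[[p q] r] s] free [u [v [w [GE -> -> -> /= ->]]]].
rewrite GE in free *; have := omegas_neq0 free.
rewrite neq_lt subr_le0 => /orP[P0|P0]; last first.
  by rewrite gtr0_norm //; move=> le0; exact: discrete_transv_group.
rewrite ltr0_norm // => le0; rewrite transv_group_swap.
have e (a b : R * R) : omega a b = - omega b a by rewrite /omega; ring.
apply: discrete_transv_group; rewrite (e v u) (e u w) (e w v).
  by rewrite !sqrrN; lra.
by lra.
Qed.

End Termination.

(** * The program *)

Section RealRAM.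
Variable R : realType.
Implicit Types (m : memory R) (k : seq program).

(** Quantifying over the remaining stack [k] makes executions composable. *)
Definition executes (P : program) (f : memory R -> memory R) :=
  forall k m, exists j, iter j (@step R) (P :: k, m) = (k, f m).

(** The value on [While] is a placeholder: [run] describes executions of loop-free programs. *)
Fixpoint run (P : program) m : memory R :=
  match P with
  | Skip | While _ _ => m
  | SetN a e => Memory [eta nmem m with neval m a |-> neval m e] (rmem m)
  | SetR a e => Memory (nmem m) [eta rmem m with neval m a |-> reval m e]
  | Seq P1 P2 => run P2 (run P1 m)
  | If t P1 P2 => if teval m t then run P1 m else run P2 m
  end.

Fixpoint loop_free (P : program) : bool :=
  match P with
  | While _ _ => false
  | Seq P1 P2 | If _ P1 P2 => loop_free P1 && loop_free P2
  | _ => true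
  end.

Lemma executes_run P : loop_free P -> executes P (run P).
Proof.
elim: P => //=.
- by move=> _ k m; exists 1%N.
- by move=> a e _ k m; exists 1%N.
- by move=> a e _ k m; exists 1%N.
- move=> P1 IH1 P2 IH2 /andP[l1 l2] k m.
  have [j1 e1] := IH1 l1 (P2 :: k) m; have [j2 e2] := IH2 l2 k (run P1 m).
  by exists (j2 + (j1 + 1))%N; rewrite !iterD /= e1 e2.
- move=> t P1 IH1 P2 IH2 /andP[l1 l2] k m.
  have [j1 e1] := IH1 l1 k m; have [j2 e2] := IH2 l2 k m.
  by case: ifP => tm; [exists (j1 + 1)%N|exists (j2 + 1)%N];
    rewrite iterD /= tm.
Qed.

Lemma iter_step_halted j m : iter j (@step R) ([::], m) = ([::], m).
Proof. by elim: j => //= j ->. Qed.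

(** Steps are deterministic and a halted configuration is fixed, so the truncated difference [n - j]
    is correct even when [j] exceeds [n]. *)
Lemma iter_step_tail n j (c c' : config R) m :
  iter n (@step R) c = ([::], m) -> iter j (@step R) c = c' ->
  iter (n - j) (@step R) c' = ([::], m).
Proof.
move=> hn <-; have [jn|nj] := leqP j n; first by rewrite -iterD subnK.
rewrite -(subnK (ltnW nj)) iterD hn iter_step_halted.
by rewrite iter_step_halted.
Qed.

Lemma while_halts P f t k m m' n : executes P f ->
  iter n (@step R) (While t P :: k, m) = ([::], m') ->
  exists i, ~~ teval (iter i f m) t /\
    exists n', iter n' (@step R) (k, iter i f m) = ([::], m').
Proof.
move=> Pf; elim/ltn_ind: n m => -[//|n] IH m; rewrite iterSr /=.
case: ifP => tm hn; last by exists 0%N; rewrite /= tm; split=> //; exists n.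
have [j ej] := Pf (While t P :: k) m.
have /IH : iter (n - j) (@step R) (While t P :: k, f m) = ([::], m').
  exact: iter_step_tail hn ej.
rewrite ltnS leq_subr => /(_ isT)[i [ti hi]].
by exists i.+1; rewrite iterSr.
Qed.

(** The loop may stop before the iteration [i] at which the test is known to fail, hence a separate
    [i']. *)
Lemma while_exits P f t k m i : executes P f -> ~~ teval (iter i f m) t ->
  exists i' j, iter j (@step R) (While t P :: k, m) = (k, iter i' f m).
Proof.
move=> Pf; elim: i m => [|i IH] m ti.
  by exists 0%N, 1%N; rewrite /= (negPf ti).
have [tm|tm] := boolP (teval m t); last by exists 0%N, 1%N; rewrite /= (negPf tm).
rewrite iterSr in ti; have [i' [j ej]] := IH _ ti.
have [j1 e1] := Pf (While t P :: k) m.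
by exists i'.+1, (j + (j1 + 1))%N; rewrite !iterD [iter i'.+1 _ _]iterSr /= tm e1 ej.
Qed.

(** Register 0 is set to 1 right after the loop, so halting and answering [true] are the same
    event. *)
Lemma outputs_loop P f t P0 m answer : loop_free P0 -> executes P f ->
  outputs (Seq P0 (Seq (While t P) (SetN (NConst 0) (NConst 1)))) m answer ->
  answer = true /\ exists i, ~~ teval (iter i f (run P0 m)) t.
Proof.
move=> lP0 Pf [n [m' [hn ->]]]; rewrite /halts_in in hn.
set k := [:: Seq (While t P) (SetN (NConst 0) (NConst 1))].
have [j ej] := executes_run lP0 k m.
have e1 : iter (1 + (j + 1)) (@step R)
    ([:: Seq P0 (Seq (While t P) (SetN (NConst 0) (NConst 1)))], m) =
    ([:: While t P; SetN (NConst 0) (NConst 1)], run P0 m).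
  by rewrite !iterD /= ej.
have [i [ti [n' hn']]] := while_halts Pf (iter_step_tail hn e1).
split; last by exists i.
have := iter_step_tail (j := 1) hn' (erefl _); rewrite iter_step_halted.
by move=> [<-].
Qed.

Lemma loop_outputs P f t P0 m i : loop_free P0 -> executes P f ->
  ~~ teval (iter i f (run P0 m)) t ->
  outputs (Seq P0 (Seq (While t P) (SetN (NConst 0) (NConst 1)))) m true.
Proof.
move=> lP0 Pf ti.
have [j ej] := executes_run lP0 [:: Seq (While t P) (SetN (NConst 0) (NConst 1))] m.
have [i' [j' ej']] := while_exits [:: SetN (NConst 0) (NConst 1)] Pf ti.
exists (1 + (j' + (1 + (j + 1))))%N.
by eexists; split; [rewrite /halts_in !iterD /= ej /= ej' /=|].
Qed.

End RealRAM.

(** * Text of the program *)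

Definition rreg n := RReg (NConst n).
Definition RSub e1 e2 := RAdd e1 (ROpp e2).
Definition RNat n := RConst n%:R.

Definition abs_reg n :=
  If (RLt (rreg n) (RNat 0)) (SetR (NConst n) (ROpp (rreg n))) Skip.

(** Register 15 is updated last, because the new value of register [k] uses its old value. *)
Definition slide_reg i j k :=
  Seq (SetR (NConst k) (RSub (RAdd (rreg k) (RMul (rreg i) (rreg j)))
                             (RMul (RNat 2) (rreg 15))))
      (SetR (NConst 15) (RSub (rreg 15) (RMul (rreg i) (rreg j)))).

Definition slidable i j k := RLt (RMul (rreg i) (rreg j)) (RMul (RNat 4) (rreg k)).

Definition slide_program :=
  Seq (abs_reg 15)
      (If (slidable 12 13 14) (slide_reg 12 13 14)
          (If (slidable 13 14 12) (slide_reg 13 14 12) (slide_reg 14 12 13))).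

(** Register 15 may be negative when the test is evaluated, so its absolute value is compared
    through two inequalities. *)
Definition kappa_gt0 :=
  let S := RAdd (RAdd (rreg 12) (rreg 13)) (rreg 14) in
  TAnd (RLt (rreg 15) S) (RLt (ROpp (rreg 15)) S).

Definition mx_expr : Type := (rexpr * rexpr * rexpr * rexpr)%type.

Definition mul_expr (X Y : mx_expr) : mx_expr :=
  let: (a, b, c, d) := X in let: (a', b', c', d') := Y in
  (RAdd (RMul a a') (RMul b c'), RAdd (RMul a b') (RMul b d'),
   RAdd (RMul c a') (RMul d c'), RAdd (RMul c b') (RMul d d')).

Definition tr_expr (X : mx_expr) : rexpr := let: (a, b, c, d) := X in RAdd a d.

(* For a matrix A of trace +- 2, (tr A / 2) A is the lift of trace 2. *)
Definition nilpotent_expr n : mx_expr :=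
  let t := RMul (RAdd (rreg n) (rreg n.+3)) (RInv (RNat 2)) in
  (RSub (RMul t (rreg n)) (RNat 1), RMul t (rreg n.+1),
   RMul t (rreg n.+2), RSub (RMul t (rreg n.+3)) (RNat 1)).

(** Traces of products of nilpotent parts are, up to sign, the squared pairings and the triple
    product, so no square root is ever taken. *)
Definition init_program :=
  let A := nilpotent_expr 0 in let B := nilpotent_expr 4 in
  let C := nilpotent_expr 8 in
  Seq (Seq (SetR (NConst 12) (tr_expr (mul_expr A B))) (abs_reg 12))
 (Seq (Seq (SetR (NConst 13) (tr_expr (mul_expr B C))) (abs_reg 13))
 (Seq (Seq (SetR (NConst 14) (tr_expr (mul_expr C A))) (abs_reg 14))
      (SetR (NConst 15) (tr_expr (mul_expr (mul_expr A B) C))))).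

Definition discreteness_program :=
  Seq init_program
      (Seq (While kappa_gt0 slide_program) (SetN (NConst 0) (NConst 1))).

(** * From program text to moves and transvections *)

Section Program.
Variable R : realType.
Implicit Types (m : memory R).

Definition state m : R * R * R * R := (rmem m 12, rmem m 13, rmem m 14, rmem m 15).

Lemma run_abs_reg n m : exists2 m', run (abs_reg n) m = m' &
  forall l, rmem m' l = if l == n then `|rmem m n| else rmem m l.
Proof.
exists (run (abs_reg n) m) => // l; rewrite /= ratr_nat.
by case: ltrP => h /=; case: eqVneq => [e|//]; rewrite ?e ?(ltr0_norm h) ?(ger0_norm h).
Qed.

Lemma state_slide m : state (run slide_program m) = slide_state (state m).
Proof.
have [m' m'0 m'E] := run_abs_reg 15 m.
have -> : run slide_program m = run (If (slidable 12 13 14) (slide_reg 12 13 14)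
    (If (slidable 13 14 12) (slide_reg 13 14 12) (slide_reg 14 12 13))) m'.
  by rewrite -m'0.
rewrite /state /slide_state /= !m'E /= !ratr_nat.
by case: ifP => _ /=; rewrite ?m'E ?ratr_nat //; case: ifP => _ /=; rewrite !m'E ?ratr_nat.
Qed.

Lemma state_iter_slide i m :
  state (iter i (run slide_program) m) = iter i (@slide_state R) (state m).
Proof. by elim: i => //= i IH; rewrite state_slide IH. Qed.

Lemma kappa_gt0E m : teval m kappa_gt0 = (0 < kappa (state m)).
Proof. by rewrite /= subr_gt0 ltr_norml andbC ltrNl. Qed.

Definition eval_mx m (X : mx_expr) : 'M[R]_2 :=
  let: (a, b, c, d) := X in mx2 (reval m a) (reval m b) (reval m c) (reval m d).

Lemma eval_mul_expr m X Y : eval_mx m (mul_expr X Y) = eval_mx m X *m eval_mx m Y.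
Proof. by case: X Y => [[[a b] c] d] [[[a' b'] c'] d']; rewrite mul_mx2. Qed.

Lemma reval_tr_expr m X : reval m (tr_expr X) = \tr (eval_mx m X).
Proof. by case: X => [[[a b] c] d]; rewrite mxtrace_mx2. Qed.

Definition nilpotent_part (A : 'M[R]_2) : 'M[R]_2 := (\tr A / 2) *: A - 1%:M.

Lemma eval_nilpotent_expr m n (A : 'M[R]_2) :
  [/\ rmem m n = A 0 0, rmem m n.+1 = A 0 1, rmem m n.+2 = A 1 0 &
      rmem m n.+3 = A 1 1] ->
  eval_mx m (nilpotent_expr n) = nilpotent_part A.
Proof.
move=> [e0 e1 e2 e3]; rewrite /nilpotent_part (mx2P A) mxtrace_mx2 scale_mx2.
rewrite /eval_mx /nilpotent_expr /= !ratr_nat e0 e1 e2 e3 [RHS]mx2P mx2_scalar.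
by congr mx2; rewrite !mxE /= ?mxE ?subr0.
Qed.

Lemma state_init (A B C : SL2 R) :
  state (run init_program (input A B C)) =
  (`|\tr (nilpotent_part A *m nilpotent_part B)|,
   `|\tr (nilpotent_part B *m nilpotent_part C)|,
   `|\tr (nilpotent_part C *m nilpotent_part A)|,
   \tr (nilpotent_part A *m nilpotent_part B *m nilpotent_part C)).
Proof.
have load (m : memory R) : (forall l, (l < 12)%N -> rmem m l = rmem (input A B C) l) ->
    [/\ eval_mx m (nilpotent_expr 0) = nilpotent_part A,
        eval_mx m (nilpotent_expr 4) = nilpotent_part B &
        eval_mx m (nilpotent_expr 8) = nilpotent_part C].
  by move=> mE; split; apply: eval_nilpotent_expr; rewrite !mE.
have set_abs (m : memory R) n e :
    exists2 m', run (Seq (SetR (NConst n) e) (abs_reg n)) m = m' &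
    forall l, rmem m' l = if l == n then `|reval m e| else rmem m l.
  have [m' hm' m'E] := run_abs_reg n (run (SetR (NConst n) e) m).
  by exists m' => // l; rewrite m'E /= eqxx; case: eqP.
have [m1 m10 m1E] := set_abs (input A B C) 12%N
  (tr_expr (mul_expr (nilpotent_expr 0) (nilpotent_expr 4))).
have [m2 m20 m2E] := set_abs m1 13%N
  (tr_expr (mul_expr (nilpotent_expr 4) (nilpotent_expr 8))).
have [m3 m30 m3E] := set_abs m2 14%N
  (tr_expr (mul_expr (nilpotent_expr 8) (nilpotent_expr 0))).
have in1 l : (l < 12)%N -> rmem m1 l = rmem (input A B C) l.
  by move=> l12; rewrite m1E ltn_eqF.
have in2 l : (l < 12)%N -> rmem m2 l = rmem (input A B C) l.
  by move=> l12; rewrite m2E ltn_eqF ?in1 // ltnW.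
have in3 l : (l < 12)%N -> rmem m3 l = rmem (input A B C) l.
  by move=> l12; rewrite m3E ltn_eqF ?in2 // ltnW // ltnW.
have [a0 b0 c0] := load _ (fun l _ => erefl (rmem (input A B C) l)).
have [a1 b1 c1] := load _ in1; have [a2 b2 c2] := load _ in2.
have [a3 b3 c3] := load _ in3.
have -> : run init_program (input A B C) = run (SetR (NConst 15)
    (tr_expr (mul_expr (mul_expr (nilpotent_expr 0) (nilpotent_expr 4))
      (nilpotent_expr 8)))) m3 by rewrite -m30 -m20 -m10.
congr (_, _, _, _).
- rewrite -[LHS]/(rmem m3 12) m3E -[LHS]/(rmem m2 12) m2E -[LHS]/(rmem m1 12) m1E.
  by rewrite reval_tr_expr eval_mul_expr a0 b0.
- rewrite -[LHS]/(rmem m3 13) m3E -[LHS]/(rmem m2 13) m2E.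
  by rewrite reval_tr_expr eval_mul_expr b1 c1.
- rewrite -[LHS]/(rmem m3 14) m3E.
  by rewrite reval_tr_expr eval_mul_expr c2 a2.
- rewrite -[LHS]/(reval m3 (tr_expr (mul_expr (mul_expr (nilpotent_expr 0)
    (nilpotent_expr 4)) (nilpotent_expr 8)))).
  by rewrite reval_tr_expr !eval_mul_expr a3 b3 c3.
Qed.

(** A positive semidefinite symmetric matrix of determinant 0 is [u] times its transpose; the sign
    of [c] is put on the second coordinate. *)
Lemma sqrt_pair (a b c : R) : 0 <= a -> 0 <= b -> a * b = c ^+ 2 ->
  exists u : R * R, [/\ u.1 * u.1 = a, u.2 * u.2 = b & u.1 * u.2 = c].
Proof.
move=> a0 b0 abc; have sqrt2 (d : R) : 0 <= d -> Num.sqrt d * Num.sqrt d = d.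
  by move=> d0; rewrite -expr2 sqr_sqrtr.
have abs : Num.sqrt a * Num.sqrt b = `|c| by rewrite -sqrtrM // abc sqrtr_sqr.
exists (Num.sqrt a, if c < 0 then - Num.sqrt b else Num.sqrt b) => /=.
split; [exact: sqrt2|by case: ifP; rewrite ?mulrNN sqrt2|].
by case: ltrP => c0; rewrite ?mulrN abs ?(ltr0_norm c0) ?opprK ?(ger0_norm c0).
Qed.

Lemma parabolic_transv (A : SL2 R) : `|\tr A| = 2 ->
  exists u (e : bool), nilpotent_part A = transv_mx u ((-1) ^+ e) - 1%:M /\
    \pi_(PSL2 R) A = \pi_(PSL2 R) (transv u ((-1) ^+ e)).
Proof.
move=> trA; pose t := \tr A / 2; have t1 : t = 1 \/ t = -1.
  by move: trA; rewrite /t; case: ger0P => _ h; [left|right]; lra.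
suff [u [e tAE]] : exists u (e : bool), t *: SL2_val A = transv_mx u ((-1) ^+ e).
  exists u, e; rewrite /nilpotent_part -/t tAE; split=> //; apply/pi_eqP.
  by rewrite /= -tAE; case: t1 => ->; [left; rewrite scale1r|right; rewrite scaleN1r opprK].
have tt : t * t = 1 by case: t1 => ->; ring.
pose M := t *: SL2_val A; have ME : M = mx2 (M 0 0) (M 0 1) (M 1 0) (M 1 1) := mx2P M.
have trM : M 0 0 + M 1 1 = 2.
  rewrite -(mxtrace_mx2 _ (M 0 1) (M 1 0)) -ME linearZ /=.
  have -> : \tr A = 2 * t by rewrite /t; field.
  by rewrite mulrCA tt mulr1.
have detM : M 0 0 * M 1 1 - M 0 1 * M 1 0 = 1.
  by rewrite -det_mx2 -ME detZ SL2_det expr2 tt mulr1.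
rewrite -/M ME; move: (M 0 0) (M 0 1) (M 1 0) (M 1 1) trM detM => a b c d trM detM.
have [m aE dE] : exists2 m, a = 1 - m & d = 1 + m by exists (1 - a); lra.
have bc : b * c = - m ^+ 2 by move: detM; rewrite aE dE; lra.
have := sqr_ge0 m.
(* Since [b * c <= 0], the signs of [b] and [c] decide the orientation; in the two mixed cases one
   of the entries is 0. *)
have [b0|b0] := leP 0 b; have [c0|c0] := leP c 0 => m0.
- have [|||u [u1 u2 u12]] := @sqrt_pair b (- c) m; try lra.
  by exists u, false; rewrite expr0 aE dE /transv_mx; congr mx2; lra.
- have [|||u [u1 u2 u12]] := @sqrt_pair (- b) c (- m); rewrite ?sqrrN; try lra; first nra.
  by exists u, true; rewrite expr1 aE dE /transv_mx; congr mx2; lra.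
- have [|||u [u1 u2 u12]] := @sqrt_pair (- b) c (- m); rewrite ?sqrrN; try lra; first nra.
  by exists u, true; rewrite expr1 aE dE /transv_mx; congr mx2; lra.
- have [|||u [u1 u2 u12]] := @sqrt_pair (- b) c (- m); rewrite ?sqrrN; try lra.
  by exists u, true; rewrite expr1 aE dE /transv_mx; congr mx2; lra.
Qed.

End Program.

Section Correctness.
Variable R : realType.

(** Each factor is the rank-one map sending [q] to a multiple of [omega u q] times [u], so the trace
    of the product is a cyclic product of pairings. *)
Lemma tr_nilpotent2 (u v : R * R) (s t : R) :
  \tr ((transv_mx u s - 1%:M) *m (transv_mx v t - 1%:M)) =
  - (s * t) * omega u v ^+ 2.
Proof.
rewrite (mx2P (transv_mx u s - _)) (mx2P (transv_mx v t - _)) mul_mx2 mxtrace_mx2.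
by rewrite !mxE /= /omega; ring.
Qed.

Lemma tr_nilpotent3 (u v w : R * R) (s t r : R) :
  \tr ((transv_mx u s - 1%:M) *m (transv_mx v t - 1%:M) *m (transv_mx w r - 1%:M)) =
  s * t * r * (omega u v * omega v w * omega w u).
Proof.
rewrite (mx2P (transv_mx u s - _)) (mx2P (transv_mx v t - _)).
rewrite (mx2P (transv_mx w r - _)) !mul_mx2 mxtrace_mx2.
by rewrite !mxE /= /omega; ring.
Qed.

Lemma transv_group_signs (u v w : R * R) (e f g : bool) :
  generated_subgroup [set \pi_(PSL2 R) (transv u ((-1) ^+ e));
    \pi_(PSL2 R) (transv v ((-1) ^+ f)); \pi_(PSL2 R) (transv w ((-1) ^+ g))] =
  transv_group u v w.
Proof.
have sign (H : set (PSL2 R)) (a : R * R) (b c : bool) : subgroup H ->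
    H (\pi_(PSL2 R) (transv a ((-1) ^+ b))) -> H (\pi_(PSL2 R) (transv a ((-1) ^+ c))).
  move=> sH Ha; have [<-//|bc] := eqVneq b c.
  have -> : (-1) ^+ c = - (-1) ^+ b :> R.
    by case: b c bc {Ha} => -[]; rewrite ?expr0 ?expr1 ?opprK.
  by rewrite -transvV -pi_invg; exact: subgroupV.
apply: generated_eq => h [[->|->]|->].
- by apply: (@sign _ u false e (subgroup_generated _)); apply: sub_generated; left; left.
- by apply: (@sign _ v false f (subgroup_generated _)); apply: sub_generated; left; right.
- by apply: (@sign _ w false g (subgroup_generated _)); apply: sub_generated; right.
- by apply: (@sign _ u e false (subgroup_generated _)); apply: sub_generated; left; left.
- by apply: (@sign _ v f false (subgroup_generated _)); apply: sub_generated; left; right.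
- by apply: (@sign _ w g false (subgroup_generated _)); apply: sub_generated; right.
Qed.

Lemma init_invariants (A B C : SL2 R) :
  `|\tr A| = 2 -> `|\tr B| = 2 -> `|\tr C| = 2 ->
  has_invariants (generated_subgroup
      [set \pi_(PSL2 R) A; \pi_(PSL2 R) B; \pi_(PSL2 R) C])
    (state (run init_program (input A B C))).
Proof.
move=> /parabolic_transv[u [e [nA ->]]] /parabolic_transv[v [f [nB ->]]].
move=> /parabolic_transv[w [g [nC ->]]].
rewrite state_init nA nB nC !tr_nilpotent2 tr_nilpotent3 transv_group_signs.
by exists u, v, w; split=> //;
  rewrite ?mulNr ?normrN !normrM !normr_sign !mul1r // -expr2 real_normK ?num_real.
Qed.

Lemma has_invariants_iter (G : set (PSL2 R)) n st :
  has_invariants G st -> has_invariants G (iter n (@slide_state R) st).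
Proof. by move=> inv; elim: n => //= n; exact: slide_state_invariants. Qed.

End Correctness.

Theorem theorem1p4 (R : realType) :
  exists P : program, forall A B C : SL2 R,
    let a := \pi_(PSL2 R) A in
    let b := \pi_(PSL2 R) B in
    let c := \pi_(PSL2 R) C in
    let G := generated_subgroup [set a; b; c] in
    parabolic a -> parabolic b -> parabolic c ->
    ~ elementary G -> free_of_rank 3 G ->
    (forall answer, outputs P (input A B C) answer ->
       (answer = true <-> discrete_subgroup G)) /\
    ((forall g, G g -> ~ elliptic g) ->
       exists answer, outputs P (input A B C) answer).
Proof.
exists discreteness_program => A B C a b c G [_ trA] [_ trB] [_ trC] _ free.
rewrite !abs_trace_pi in trA trB trC.
have inv := init_invariants trA trB trC; rewrite -/G in inv.
have body : executes slide_program (run (R := R) slide_program) by exact: executes_run.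
(* A halted run answers [true], so only the discreteness of [G] has to be derived, from [kappa <= 0]
   at exit. *)
split=> [answer /(outputs_loop (isT : loop_free init_program) body)[-> [i]]|noell].
  rewrite kappa_gt0E state_iter_slide -leNgt => k0; split=> // _.
  exact: discrete_of_kappa_le0 free (has_invariants_iter i inv) k0.
have [i k0] := slide_state_terminates noell free inv; exists true.
apply: (@loop_outputs R slide_program (run slide_program) kappa_gt0 init_program _ i) => //.
by rewrite kappa_gt0E state_iter_slide -leNgt.
Qed.
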